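(* Let $\mathbf{k}$ be a Noetherian commutative ring and let $V$ be a finitely generated FI-module over $\mathbf{k}$ generated in degree $\le D$, i.e. $V$ admits a surjection $$\Pi:\tilde V:=\bigoplus_{i=1}^d M(m_i)\twoheadrightarrow V,\qquad m_i\le D \text{ for each } i.$$ Then: (A) for all large enough $a$, the shifted FI-module $S_{+a}V$ is $\sharp$-filtered; (B) there are an integer $N\ge 0$, a constant $C\geq 0$, $\sharp$-filtered FI-modules $\Pi^i:\tilde J^i\twoheadrightarrow J^i$ ($0\le i\le N$), and a commutative diagram of FI-modules consisting of a top row $$0\to\tilde V\xrightarrow{\tilde\iota}\tilde J^0\xrightarrow{\tilde\phi^0}\tilde J^1\xrightarrow{\tilde\phi^1}\cdots\xrightarrow{\tilde\phi^{N-1}}\tilde J^N\to 0,$$ a bottom row $$0\to V\xrightarrow{\iota}J^0\xrightarrow{\phi^0}J^1\xrightarrow{\phi^1}\cdots\xrightarrow{\phi^{N-1}}J^N\to 0,$$ and vertical surjections $\Pi,\Pi^0,\dots,\Pi^N$ from the top row to the bottom row, such that the top row is exact, and the bottom row is exact in high enough degree, i.e. $0\to V_n\to J^0_n\to J^1_n\to\cdots\to J^N_n\to 0$ is exact for all $n\ge C$. For each $0\le i\le N-1$ the map $\phi^i$ is sequential, with sequentialness witnessed by $\tilde\phi^i$. Moreover $N\le D$ and $\tilde J^i$ is generated in degree at most $D-i$.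
   Context: FI is the category of finite sets and injections. An FI-module over a commutative ring $\mathbf{k}$ is a functor $V$ from FI to $\mathbf{k}$-modules; $[n]=\{1,\dots,n\}$, $V_n=V([n])$ (a $\mathbf{k}[\mathfrak S_n]$-module). Kernels, cokernels, exactness, injectivity, surjectivity are pointwise. $M(m)=\mathbf{k}[\mathrm{Hom}_{FI}([m],-)]$; for a $\mathbf{k}[\mathfrak S_m]$-module $W$, $M(W)$ is the FI-module $S\mapsto \mathbf{k}[\mathrm{Hom}_{FI}([m],S)]\otimes_{\mathbf{k}[\mathfrak S_m]}W$. $V$ is finitely generated if there is a surjection $\bigoplus_{i=1}^dM(m_i)\twoheadrightarrow V$ (finite sum); it is generated in degree $\le D$ if there is a surjection $\bigoplus_{i\in I}M(m_i)\twoheadrightarrow V$ with all $m_i\le D$. Shift: $(S_{+a}V)_S=V_{S\sqcup[a]}$. A $\sharp$-filtered FI-module is a surjection $\Pi:\bigoplus_{i=1}^dM(m_i)\twoheadrightarrow V$ (the order of the tuple $(m_1,\dots,m_d)$ being part of the data) such that, with $V^r:=\Pi(\bigoplus_{i=1}^rM(m_i))$, for every $1\le r\le d$ one has $V^r/V^{r-1}\cong M(W_r)$ for some $\mathbf{k}[\mathfrak S_{m_r}]$-module $W_r$. The source $\tilde V=\bigoplus_iM(m_i)$ is called a cover of $V$. An FI-module is called $\sharp$-filtered if it admits such a surjection. Let $\Pi^1:\bigoplus_{i=1}^{d_1}M(m_i)\to V$ and $\Pi^2:\bigoplus_{k=1}^{d_2}M(n_k)\to W$ be $\sharp$-filtered.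 A map $\phi:V\to W$ of FI-modules is sequential if there are subsets $S\subset[d_1]$, $T\subset[d_2]$ and a bijection $f_\phi:S\to T$ with $n_k=m_{f_\phi^{-1}(k)}$ for $k\in T$, such that the map of covers $\tilde\phi$ given by $(\tilde\phi_n(L))_k=L_{f_\phi^{-1}(k)}$ if $k\in T$ and $0$ otherwise satisfies $\phi\circ\Pi^1=\Pi^2\circ\tilde\phi$; then $\tilde\phi$ is said to witness sequentialness. *)

(* Defs.v *)
From HB Require Import structures.
From mathcomp Require Import all_boot all_order all_algebra all_fingroup.
From mathcomp Require Import boolp classical_sets functions cardinality fsbigop.
From mathcomp Require Import finmap generic_quotient ring_quotient.

Set Implicit Arguments.
Unset Strict Implicit.
Unset Printing Implicit Defensive.

Import GRing.Theory.

Local Open Scope classical_set_scope.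
Local Open Scope ring_scope.

Record submod (k : comPzRingType) (M : lmodType k) := Submod {
  submod_set :> M -> Prop;
  submod0 : submod_set 0;
  submodD : forall u v, submod_set u -> submod_set v -> submod_set (u + v);
  submodZ : forall (a : k) u, submod_set u -> submod_set (a *: u)
}.

Definition submod_pred (k : comPzRingType) (M : lmodType k) (N : submod M) :
  {pred M} := fun x => `[< N x >].

Lemma submod_predP (k : comPzRingType) (M : lmodType k) (N : submod M) x :
  reflect (N x) (x \in submod_pred N).
Proof. exact: asboolP. Qed.

Lemma submod_pred_closed (k : comPzRingType) (M : lmodType k) (N : submod M) :
  subsemimod_closed (submod_pred N).
Proof.
split; first split.
- exact/submod_predP/submod0.
- by move=> u v /submod_predP Nu /submod_predP Nv; apply/submod_predP/submodD.
- by move=> a u /submod_predP Nu; apply/submod_predP/submodZ.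
Qed.

HB.instance Definition _ (k : comPzRingType) (M : lmodType k) (N : submod M) :=
  GRing.isSubmodClosed.Build k M (submod_pred N) (submod_pred_closed N).

Section SubmodType.
Variables (k : comPzRingType) (M : lmodType k) (N : submod M).

Record subm := Subm { subm_val : M; subm_valP : subm_val \in submod_pred N }.

HB.instance Definition _ := [isSub for subm_val].
HB.instance Definition _ := [Choice of subm by <:].
HB.instance Definition _ := [SubChoice_isSubLmodule of subm by <:].

Definition quotm := Quotient.quot (submod_pred N).

HB.instance Definition _ := GRing.Zmodule.on quotm.

Definition qpi (x : M) : quotm := \pi_(Quotient.quot (submod_pred N))%qT x.

Lemma qpi_eq x y : qpi x = qpi y <-> N (x - y).
Proof.
rewrite /qpi; split => [/eqP|Nxy]; last apply/eqP.
  by rewrite -Quotient.idealrBE => /submod_predP.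
by rewrite -Quotient.idealrBE; apply/submod_predP.
Qed.

Lemma qpiK (x : quotm) : qpi (repr x) = x.
Proof. exact: reprK. Qed.

Lemma qpiB : {morph qpi : x y / x - y}.
Proof. by move=> x y; exact: (raddfB (\pi_(Quotient.quot (submod_pred N)))%qT). Qed.

Lemma qpiD : {morph qpi : x y / x + y}.
Proof. by move=> x y; exact: (raddfD (\pi_(Quotient.quot (submod_pred N)))%qT). Qed.

Definition qscale (a : k) (x : quotm) : quotm := qpi (a *: repr x).

Lemma qpiZ a x : qpi (a *: x) = qscale a (qpi x).
Proof.
by apply/qpi_eq; rewrite -scalerBr; apply: submodZ; apply/qpi_eq; rewrite qpiK.
Qed.

Lemma qscalerA a b v : qscale a (qscale b v) = qscale (a * b) v.
Proof. by rewrite -[v]qpiK -!qpiZ scalerA. Qed.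

Lemma qscale1r : left_id 1 qscale.
Proof. by move=> v; rewrite -[v]qpiK -!qpiZ scale1r. Qed.

Lemma qscalerDr : right_distributive qscale +%R.
Proof. by move=> a u v; rewrite -[u]qpiK -[v]qpiK -qpiD -!qpiZ scalerDr qpiD. Qed.

Lemma qscalerDl v : {morph qscale^~ v : a b / a + b}.
Proof. by move=> a b; rewrite -[v]qpiK -!qpiZ scalerDl qpiD. Qed.

HB.instance Definition _ :=
  GRing.Zmodule_isLmodule.Build k quotm qscalerA qscale1r qscalerDr qscalerDl.

Lemma qpi_is_linear : linear qpi.
Proof. by move=> a u v; rewrite qpiD qpiZ. Qed.

HB.instance Definition _ := GRing.isLinear.Build k M quotm _ qpi qpi_is_linear.

End SubmodType.

Section SubQuotMaps.
Variables (k : comPzRingType) (M M' : lmodType k) (N : submod M) (N' : submod M').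
Variables (h : {linear M -> M'}) (hN : forall x, N x -> N' (h x)).

Fact subm_map_subproof (x : subm N) : h (val x) \in submod_pred N'.
Proof. by apply/submod_predP/hN/submod_predP/(valP x). Qed.

Definition subm_map (x : subm N) : subm N' := Subm (subm_map_subproof x).

Lemma subm_map_is_linear : linear subm_map.
Proof. by move=> a u v; apply: val_inj; rewrite /= !linearP. Qed.

HB.instance Definition _ :=
  GRing.isLinear.Build k (subm N) (subm N') _ subm_map subm_map_is_linear.

Definition quotm_fun (x : quotm N) : quotm N' := qpi N' (h (repr x)).

Fact quotm_funE x : quotm_fun (qpi N x) = qpi N' (h x).
Proof. by apply/qpi_eq; rewrite -linearB; apply/hN/qpi_eq/qpiK. Qed.

Fact quotm_fun_is_linear : linear quotm_fun.
Proof.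
move=> a u v; rewrite -[u]qpiK -[v]qpiK -(linearP (qpi N)).
by rewrite !quotm_funE !linearP.
Qed.

Definition quotm_map : {linear quotm N -> quotm N'} :=
  HB.pack_for {linear quotm N -> quotm N'} quotm_fun
    (GRing.isLinear.Build k (quotm N) (quotm N') _ quotm_fun quotm_fun_is_linear).

Lemma quotm_mapE x : quotm_map (qpi N x) = qpi N' (h x).
Proof. exact: quotm_funE. Qed.

End SubQuotMaps.

Arguments subm_map {k M M' N N' h} hN x.
Arguments quotm_map {k M M' N N' h} hN.
Arguments quotm_mapE {k M M' N N' h} hN x.

Lemma subm_linear (k : comPzRingType) (M : lmodType k) (N : submod M) :
  linear (@subm_val k M N).
Proof. by []. Qed.

HB.instance Definition _ (k : comPzRingType) (M : lmodType k) (N : submod M) :=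
  GRing.isLinear.Build k (subm N) M _ (@subm_val k M N) (@subm_linear k M N).

Section Span.
Variables (k : comPzRingType) (M : lmodType k) (G : set M).

Definition span_set : set M := fun x => forall N : submod M, (forall y, G y -> N y) -> N x.

Fact span0 : span_set 0. Proof. by move=> N _; apply: submod0. Qed.
Fact spanD u v : span_set u -> span_set v -> span_set (u + v).
Proof. by move=> Gu Gv N GN; apply: submodD; [exact: Gu|exact: Gv]. Qed.
Fact spanZ a u : span_set u -> span_set (a *: u).
Proof. by move=> Gu N GN; apply: submodZ; exact: Gu. Qed.

Definition mspan : submod M := Submod span0 spanD spanZ.

End Span.

(** The ideals of [k] are the submodules of the regular module [k^o]. *)
Definition noetherian (k : comPzRingType) : Prop :=
  forall I : submod (k^o : lmodType k),
    exists s : seq k^o, forall x : k^o, I x <-> mspan [set y | y \in s] x.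

Section DirectSum.
Variables (k : comPzRingType) (I : Type) (F : I -> lmodType k).

Record dsum := DSum {
  dsum_fun :> forall i, F i;
  dsum_fin : finite_set [set i | dsum_fun i <> 0]
}.

HB.instance Definition _ := gen_eqMixin dsum.
HB.instance Definition _ := gen_choiceMixin dsum.

Lemma dsumP (u v : dsum) : (forall i, u i = v i) -> u = v.
Proof.
case: u v => [u fu] [v fv] /= uv; have {}uv : u = v.
  exact: functional_extensionality_dep.
by rewrite -uv in fv *; congr DSum; exact: Prop_irrelevance.
Qed.

Fact dsum0_subproof : finite_set [set i | (0 : F i) <> 0].
Proof. by apply: (sub_finite_set _ (finite_set0 I)) => i /=. Qed.
Definition dsum0 : dsum := DSum dsum0_subproof.

Fact dsumD_subproof (u v : dsum) : finite_set [set i | u i + v i <> 0].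
Proof.
apply: (@sub_finite_set _ _ ([set i | u i <> 0] `|` [set i | v i <> 0])); last first.
  by rewrite finite_setU; split; exact: dsum_fin.
move=> i /= uv0; have [u0|] := pselect (u i = 0); last by left.
by right => v0; apply: uv0; rewrite u0 v0 addr0.
Qed.
Definition dsumD (u v : dsum) : dsum := DSum (dsumD_subproof u v).

Fact dsumZ_subproof (a : k) (u : dsum) : finite_set [set i | a *: u i <> 0].
Proof.
apply: (sub_finite_set _ (dsum_fin u)) => i /= au0 u0.
by apply: au0; rewrite u0 scaler0.
Qed.
Definition dsumZ (a : k) (u : dsum) : dsum := DSum (dsumZ_subproof a u).

Definition dsumN (u : dsum) : dsum := dsumZ (-1) u.

Fact dsum_addA : associative dsumD.
Proof. by move=> u v w; apply: dsumP => i /=; rewrite addrA. Qed.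
Fact dsum_addC : commutative dsumD.
Proof. by move=> u v; apply: dsumP => i /=; rewrite addrC. Qed.
Fact dsum_add0 : left_id dsum0 dsumD.
Proof. by move=> u; apply: dsumP => i /=; rewrite add0r. Qed.
Fact dsum_addN : left_inverse dsum0 dsumN dsumD.
Proof. by move=> u; apply: dsumP => i /=; rewrite scaleN1r addNr. Qed.

HB.instance Definition _ :=
  GRing.isZmodule.Build dsum dsum_addA dsum_addC dsum_add0 dsum_addN.

Fact dsum_scaleA a b v : dsumZ a (dsumZ b v) = dsumZ (a * b) v.
Proof. by apply: dsumP => i /=; rewrite scalerA. Qed.
Fact dsum_scale1 : left_id 1 dsumZ.
Proof. by move=> v; apply: dsumP => i /=; rewrite scale1r. Qed.
Fact dsum_scaleDr : right_distributive dsumZ +%R.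
Proof. by move=> a u v; apply: dsumP => i /=; rewrite scalerDr. Qed.
Fact dsum_scaleDl v : {morph dsumZ^~ v : a b / a + b}.
Proof. by move=> a b; apply: dsumP => i /=; rewrite scalerDl. Qed.

HB.instance Definition _ := GRing.Zmodule_isLmodule.Build k dsum
  dsum_scaleA dsum_scale1 dsum_scaleDr dsum_scaleDl.

End DirectSum.

Section DirectSumMap.
Variables (k : comPzRingType) (I : Type) (F G : I -> lmodType k).
Variable h : forall i, {linear F i -> G i}.

Fact dsum_map_subproof (u : dsum F) : finite_set [set i | h i (u i) <> 0].
Proof.
apply: (sub_finite_set _ (dsum_fin u)) => i /= hu0 u0.
by apply: hu0; rewrite u0 linear0.
Qed.

Definition dsum_map (u : dsum F) : dsum G := DSum (dsum_map_subproof u).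

Lemma dsum_map_is_linear : linear dsum_map.
Proof. by move=> a u v; apply: dsumP => i /=; rewrite linearP. Qed.

HB.instance Definition _ :=
  GRing.isLinear.Build k (dsum F) (dsum G) _ dsum_map dsum_map_is_linear.

End DirectSumMap.

Definition freemod (k : comPzRingType) (X : choiceType) : lmodType k :=
  dsum (fun _ : X => k^o : lmodType k).

Section FreeLift.
Variables (k : comPzRingType) (X : choiceType).

Fact delta_subproof (x : X) : finite_set [set y | (y == x)%:R <> 0 :> k^o].
Proof.
apply: (@sub_finite_set _ _ [set x]) => [y /=|]; last exact: finite_set1.
by case: eqP.
Qed.

Definition delta (x : X) : freemod k X := DSum (delta_subproof x).

Variables (M : lmodType k) (v : X -> M).

Definition free_lift (u : freemod k X) : M :=
  \sum_(x \in [set: X]) (u x : k) *: v x.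

Lemma free_liftE (A : set X) (u : freemod k X) : finite_set A ->
  [set x | u x <> 0] `<=` A -> free_lift u = \sum_(x \in A) (u x : k) *: v x.
Proof.
move=> _ uA; rewrite /free_lift; symmetry; apply: fsbig_widen => // x /= [_ nAx].
have [->|ux] := pselect (u x = 0); first by rewrite /= scale0r.
by case: nAx; apply: uA.
Qed.

Lemma free_lift_is_linear : linear free_lift.
Proof.
move=> a u w.
pose A := [set x | u x <> 0] `|` [set x | w x <> 0].
have finA : finite_set A by rewrite finite_setU; split; exact: dsum_fin.
rewrite !(@free_liftE A) //; last 3 first.
- by move=> x; right.
- by move=> x; left.
- move=> x /= uw0; have [u0|] := pselect (u x = 0); last by left.
  by right => w0; apply: uw0; rewrite u0 w0 scaler0 addr0.
rewrite !fsbig_finite //= scaler_sumr -big_split /=; apply: eq_bigr => x _.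
by rewrite scalerA -scalerDl.
Qed.

HB.instance Definition _ :=
  GRing.isLinear.Build k (freemod k X) M _ free_lift free_lift_is_linear.

Lemma free_lift_delta x : free_lift (delta x) = v x.
Proof.
rewrite (@free_liftE [set x]) ?fsbig_set1 /= ?eqxx ?scale1r //.
by move=> y /=; case: eqP.
Qed.

Lemma free_expand (u : freemod k X) :
  u = \sum_(x <- fset_set [set x | u x <> 0]) (u x : k) *: delta x.
Proof.
have finu := dsum_fin u.
apply: dsumP => y.
have sumE (s : seq X) (c : X -> k) :
  (\sum_(x <- s) c x *: delta x : freemod k X) y = \sum_(x <- s) c x * (y == x)%:R.
  by elim: s => [|x s IH]; rewrite ?big_nil // !big_cons -IH.
rewrite sumE; have [uy0|uy0] := pselect (u y = 0).
  rewrite big1_seq // => x /andP[_]; rewrite in_fset_set // => /set_mem /= ux0.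
  by case: eqP ux0 => [<-|]; rewrite ?mulr0 // uy0.
rewrite (bigD1_seq y) ?fset_uniq //=; last by rewrite in_fset_set //; apply/mem_set.
rewrite eqxx mulr1 big1 ?addr0 // => x.
by rewrite eq_sym => /negbTE ->; rewrite mulr0.
Qed.

End FreeLift.

Lemma free_ext (k : comPzRingType) (X : choiceType) (M : lmodType k)
  (f g : {linear freemod k X -> M}) :
  (forall x, f (delta k x) = g (delta k x)) -> forall u, f u = g u.
Proof.
move=> fg u; rewrite [u]free_expand !linear_sum; apply: eq_bigr => x _.
by rewrite !linearZ /= fg.
Qed.

Definition free_map (k : comPzRingType) (X Y : choiceType) (h : X -> Y) :
  {linear freemod k X -> freemod k Y} := free_lift (fun x => delta k (h x)).

Lemma free_map_delta (k : comPzRingType) (X Y : choiceType) (h : X -> Y) x :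
  free_map k h (delta k x) = delta k (h x).
Proof. exact: free_lift_delta. Qed.

Lemma free_map_id (k : comPzRingType) (X : choiceType) (h : X -> X) u :
  h =1 id -> free_map k h u = u.
Proof.
move=> hid; apply: (free_ext (f := free_map k h) (g := idfun)) => x.
by rewrite free_map_delta hid.
Qed.

Lemma free_map_comp (k : comPzRingType) (X Y Z : choiceType)
    (g : Y -> Z) (f : X -> Y) (h : X -> Z) u :
  h =1 g \o f -> free_map k h u = free_map k g (free_map k f u).
Proof.
move=> hgf.
apply: (free_ext (f := free_map k h) (g := free_map k g \o free_map k f)) => x /=.
by rewrite !free_map_delta hgf.
Qed.

(** When [ra] is a right action and [la] a left action of a group [G] by
    [k]-linear maps, [tensor ra la] is the tensor product over [k[G]]: the free
    [k]-module on [A * B] modulo bilinearity over [k] and balancedness over [G]. *)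
Section Tensor.
Variables (k : comPzRingType) (G : Type) (A B : lmodType k).
Variables (ra : A -> G -> A) (la : G -> B -> B).

Local Notation d x y := (delta k ((x, y) : (A * B)%type)).

Inductive tensor_rel : set (freemod k (A * B)%type) :=
| TensorDl x x' y : tensor_rel (d (x + x') y - d x y - d x' y)
| TensorDr x y y' : tensor_rel (d x (y + y') - d x y - d x y')
| TensorZl a x y : tensor_rel (d (a *: x) y - a *: d x y)
| TensorZr a x y : tensor_rel (d x (a *: y) - a *: d x y)
| TensorG x s y : tensor_rel (d (ra x s) y - d x (la s y)).

Definition tensor : lmodType k := quotm (mspan tensor_rel).

End Tensor.

Section TensorMap.
Variables (k : comPzRingType) (G : Type) (A A' B : lmodType k).
Variables (ra : A -> G -> A) (ra' : A' -> G -> A') (la : G -> B -> B).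
Variables (h : {linear A -> A'}) (hG : forall x s, h (ra x s) = ra' (h x) s).

Let hB (p : A * B) : A' * B := (h p.1, p.2).

Fact tensor_map_subproof x :
  mspan (tensor_rel ra la) x -> mspan (tensor_rel ra' la) (free_map k hB x).
Proof.
pose P : set (freemod k (A * B)%type) :=
  fun x => mspan (tensor_rel ra' la) (free_map k hB x).
have P0 : P 0 by rewrite /P linear0; apply: submod0.
have PD u v : P u -> P v -> P (u + v).
  by rewrite /P linearD; apply: submodD.
have PZ a u : P u -> P (a *: u).
  by rewrite /P linearZ; apply: submodZ.
move=> Hx; apply: (Hx (Submod P0 PD PZ)) => z hz /=; rewrite /P.
have sub w : tensor_rel ra' la w -> mspan (tensor_rel ra' la) w by move=> ? N; apply.
pose m := free_map k hB.
have mE a b : m (delta k (a, b)) = delta k (h a, b) by rewrite /m free_map_delta.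
rewrite -/m; case: hz => [a a' b|a b b'|c a b|c a b|a g b]; apply: sub.
- by rewrite !(linearB m) !mE (linearD h); exact: TensorDl.
- by rewrite !(linearB m) !mE; exact: TensorDr.
- by rewrite (linearB m) (linearZ_LR m) !mE (linearZ_LR h); exact: TensorZl.
- by rewrite (linearB m) (linearZ_LR m) !mE; exact: TensorZr.
- by rewrite (linearB m) !mE hG; exact: TensorG.
Qed.

Definition tensor_map : {linear tensor ra la -> tensor ra' la} :=
  quotm_map tensor_map_subproof.

End TensorMap.

Record fi_hom (S T : finType) := FIHom {
  fi_fun :> {ffun S -> T};
  fi_funP : injectiveb fi_fun
}.

HB.instance Definition _ (S T : finType) := [isSub for @fi_fun S T].
HB.instance Definition _ (S T : finType) := [Finite of fi_hom S T by <:].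

Lemma fi_hom_inj (S T : finType) (f : fi_hom S T) : injective f.
Proof. exact/injectiveP/fi_funP. Qed.

Lemma fi_hom_eq (S T : finType) (f g : fi_hom S T) : f =1 g -> f = g.
Proof. by move=> fg; apply/val_inj/ffunP. Qed.

Fact fi_of_subproof (S T : finType) (f : S -> T) :
  injective f -> injectiveb (finfun f).
Proof. by move=> fI; apply/injectiveP => x y; rewrite !ffunE => /fI. Qed.

Definition fi_of (S T : finType) (f : S -> T) (fI : injective f) : fi_hom S T :=
  FIHom (fi_of_subproof fI).

Lemma fi_ofE (S T : finType) (f : S -> T) (fI : injective f) : fi_of fI =1 f.
Proof. by move=> x; rewrite /= ffunE. Qed.

Definition fi_id (S : finType) : fi_hom S S := fi_of (@inj_id S).

Definition fi_comp (S T U : finType) (g : fi_hom T U) (f : fi_hom S T) :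
  fi_hom S U := fi_of (inj_comp (@fi_hom_inj _ _ g) (@fi_hom_inj _ _ f)).

Definition fi_perm (m : nat) (s : 'S_m) : fi_hom 'I_m 'I_m := fi_of (@perm_inj _ s).

Fact fi_add_subproof (a : nat) (S T : finType) (f : fi_hom S T) :
  injective (fun x : S + 'I_a =>
    match x with inl s => inl (f s) | inr i => inr i end : (T + 'I_a)%type).
Proof.
by move=> [s|i] [t|j] // => [[/fi_hom_inj ->]|[->]].
Qed.

Definition fi_add (a : nat) (S T : finType) (f : fi_hom S T) :
  fi_hom (S + 'I_a)%type (T + 'I_a)%type := fi_of (@fi_add_subproof a S T f).

Record fimod (k : comPzRingType) := FIMod {
  fi_obj :> finType -> lmodType k;
  fi_map : forall S T, fi_hom S T -> {linear fi_obj S -> fi_obj T};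
  fi_map_id : forall S v, fi_map (fi_id S) v = v;
  fi_map_comp : forall S T U (g : fi_hom T U) (f : fi_hom S T) v,
    fi_map (fi_comp g f) v = fi_map g (fi_map f v)
}.

Record fimor (k : comPzRingType) (V W : fimod k) := FIMor {
  fimor_at :> forall S, {linear V S -> W S};
  fimor_nat : forall S T (f : fi_hom S T) v,
    fimor_at T (fi_map V f v) = fi_map W f (fimor_at S v)
}.

Definition fi_surj (k : comPzRingType) (V W : fimod k) (p : fimor V W) : Prop :=
  forall S (w : W S), exists v, p S v = w.

Definition fi_iso (k : comPzRingType) (V W : fimod k) : Prop :=
  exists (p : fimor V W) (q : fimor W V), forall S, cancel (p S) (q S) /\ cancel (q S) (p S).

Record fisub (k : comPzRingType) (V : fimod k) := FISub {
  fisub_at :> forall S, submod (V S);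
  fisub_map : forall S T (f : fi_hom S T) v,
    fisub_at S v -> fisub_at T (fi_map V f v)
}.

Section SubQuot.
Variables (k : comPzRingType) (V : fimod k) (U : fisub V).

Definition fi_sub_map S T (f : fi_hom S T) : {linear subm (U S) -> subm (U T)} :=
  subm_map (@fisub_map k V U S T f).

Fact fi_sub_id S v : fi_sub_map (fi_id S) v = v.
Proof. by apply: val_inj; rewrite /= fi_map_id. Qed.

Fact fi_sub_comp S T Z (g : fi_hom T Z) (f : fi_hom S T) v :
  fi_sub_map (fi_comp g f) v = fi_sub_map g (fi_sub_map f v).
Proof. by apply: val_inj; rewrite /= fi_map_comp. Qed.

Definition fi_sub : fimod k := FIMod fi_sub_id fi_sub_comp.

Fact fi_incl_nat S T (f : fi_hom S T) (v : fi_sub S) :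
  subm_val (fi_map fi_sub f v) = fi_map V f (subm_val v).
Proof. by []. Qed.

Definition fi_incl : fimor fi_sub V :=
  @FIMor k fi_sub V (fun S => @subm_val k (V S) (U S)) fi_incl_nat.

Definition fi_quot_map S T (f : fi_hom S T) : {linear quotm (U S) -> quotm (U T)} :=
  quotm_map (@fisub_map k V U S T f).

Fact fi_quot_id S v : fi_quot_map (fi_id S) v = v.
Proof. by rewrite -[v]qpiK [LHS]quotm_mapE fi_map_id. Qed.

Fact fi_quot_comp S T Z (g : fi_hom T Z) (f : fi_hom S T) v :
  fi_quot_map (fi_comp g f) v = fi_quot_map g (fi_quot_map f v).
Proof. by rewrite -[v]qpiK [LHS]quotm_mapE [X in _ = _ X]quotm_mapE [RHS]quotm_mapE fi_map_comp. Qed.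

Definition fi_quot : fimod k := FIMod fi_quot_id fi_quot_comp.

End SubQuot.

Section ImagePreimage.
Variables (k : comPzRingType) (V W : fimod k) (p : fimor V W).

Section Image.
Variable U : fisub V.

Definition fi_image_set S : set (W S) := fun w => exists2 v, U S v & p S v = w.

Fact fi_image0 S : fi_image_set (0 : W S).
Proof. by exists 0; [exact: submod0|rewrite linear0]. Qed.
Fact fi_imageD S (u v : W S) : fi_image_set u -> fi_image_set v -> fi_image_set (u + v).
Proof.
move=> [x Ux <-] [y Uy <-].
by exists (x + y); [exact: submodD|rewrite linearD].
Qed.
Fact fi_imageZ S a (u : W S) : fi_image_set u -> fi_image_set (a *: u).
Proof.
by move=> [x Ux <-]; exists (a *: x); [exact: submodZ|rewrite linearZ].
Qed.

Fact fi_image_map S T (f : fi_hom S T) w : fi_image_set w -> fi_image_set (fi_map W f w).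
Proof.
move=> [v Uv <-]; exists (fi_map V f v); first exact: fisub_map.
exact: fimor_nat.
Qed.

Definition fi_image : fisub W :=
  @FISub k W (fun S => Submod (@fi_image0 S) (@fi_imageD S) (@fi_imageZ S)) fi_image_map.

End Image.

Section Preimage.
Variable U : fisub W.

Definition fi_preim_set S : set (V S) := fun v => U S (p S v).

Fact fi_preim0 S : fi_preim_set (0 : V S).
Proof. by rewrite /fi_preim_set linear0; exact: submod0. Qed.
Fact fi_preimD S (u v : V S) : fi_preim_set u -> fi_preim_set v -> fi_preim_set (u + v).
Proof. by rewrite /fi_preim_set linearD; exact: submodD. Qed.
Fact fi_preimZ S a (u : V S) : fi_preim_set u -> fi_preim_set (a *: u).
Proof. by rewrite /fi_preim_set linearZ; exact: submodZ. Qed.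

Fact fi_preim_map S T (f : fi_hom S T) v : fi_preim_set v -> fi_preim_set (fi_map V f v).
Proof. by move=> Uv; rewrite /fi_preim_set fimor_nat; exact: fisub_map. Qed.

Definition fi_preim : fisub V :=
  @FISub k V (fun S => Submod (@fi_preim0 S) (@fi_preimD S) (@fi_preimZ S)) fi_preim_map.

End Preimage.
End ImagePreimage.

(** [U / (U :&: U')], that is [U / U'] when [U'] is contained in [U]. *)
Definition fi_subquot (k : comPzRingType) (V : fimod k) (U U' : fisub V) : fimod k :=
  fi_quot (fi_preim (fi_incl U) U').

Section Shift.
Variables (k : comPzRingType) (a : nat) (V : fimod k).

Fact fi_shift_id S v : fi_map V (fi_add a (fi_id S)) v = v.
Proof.
rewrite -[RHS]fi_map_id; congr (fi_map V _ v).
by apply: fi_hom_eq => -[x|x]; rewrite !ffunE.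
Qed.

Fact fi_shift_comp S T U (g : fi_hom T U) (f : fi_hom S T) v :
  fi_map V (fi_add a (fi_comp g f)) v = fi_map V (fi_add a g) (fi_map V (fi_add a f) v).
Proof.
rewrite -fi_map_comp; congr (fi_map V _ v).
by apply: fi_hom_eq => -[x|x]; rewrite !(ffunE, fi_ofE) //= ?ffunE.
Qed.

Definition fi_shift : fimod k :=
  @FIMod k (fun S => V (S + 'I_a)%type) (fun S T f => fi_map V (fi_add a f))
    fi_shift_id fi_shift_comp.

End Shift.

Section FIDirectSum.
Variables (k : comPzRingType) (I : Type) (V : I -> fimod k).

Definition fi_dsum_map S T (f : fi_hom S T) :
    {linear dsum (fun i => V i S) -> dsum (fun i => V i T)} :=
  dsum_map (fun i => fi_map (V i) f).

Fact fi_dsum_id S v : fi_dsum_map (fi_id S) v = v.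
Proof. by apply: dsumP => i /=; rewrite fi_map_id. Qed.

Fact fi_dsum_comp S T Z (g : fi_hom T Z) (f : fi_hom S T) v :
  fi_dsum_map (fi_comp g f) v = fi_dsum_map g (fi_dsum_map f v).
Proof. by apply: dsumP => i /=; rewrite fi_map_comp. Qed.

Definition fi_dsum : fimod k := FIMod fi_dsum_id fi_dsum_comp.

End FIDirectSum.

Section Representable.
Variables (k : comPzRingType) (m : nat).

Definition fi_M_map S T (f : fi_hom S T) :
    {linear freemod k (fi_hom 'I_m S) -> freemod k (fi_hom 'I_m T)} :=
  free_map k (fi_comp f).

Fact fi_M_id S v : fi_M_map (fi_id S) v = v.
Proof. by apply: free_map_id => h; apply: fi_hom_eq => x; rewrite !ffunE /= ?ffunE. Qed.

Fact fi_M_comp S T Z (g : fi_hom T Z) (f : fi_hom S T) v :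
  fi_M_map (fi_comp g f) v = fi_M_map g (fi_M_map f v).
Proof.
apply: free_map_comp => h.
by apply: fi_hom_eq => x; rewrite /= !ffunE /= ?ffunE.
Qed.

Definition fi_M : fimod k := FIMod fi_M_id fi_M_comp.

End Representable.

(** A left [k['S_m]]-module. The product [s * t] of permutations in the library
    is [t \o s], whence the order of the factors in [rep_actM]. *)
Record perm_rep (k : comPzRingType) (m : nat) := PermRep {
  rep_mod :> lmodType k;
  rep_act : 'S_m -> {linear rep_mod -> rep_mod};
  rep_act1 : forall w, rep_act 1%g w = w;
  rep_actM : forall s t w, rep_act (s * t)%g w = rep_act t (rep_act s w)
}.

Section Induced.
Variables (k : comPzRingType) (m : nat) (W : perm_rep k m).

Definition precomp_perm S (x : fi_M k m S) (s : 'S_m) : fi_M k m S :=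
  free_map k (fun h : fi_hom 'I_m S => fi_comp h (fi_perm s)) x.

Definition fi_ind_obj (S : finType) : lmodType k :=
  tensor (@precomp_perm S) (@rep_act k m W).

Fact fi_ind_subproof S T (f : fi_hom S T) x s :
  fi_M_map k m f (precomp_perm x s) = precomp_perm (fi_M_map k m f x) s.
Proof.
rewrite /precomp_perm /fi_M_map.
pose c := fun h : fi_hom 'I_m S => fi_comp (fi_comp f h) (fi_perm s).
have cE h : c h = fi_comp f (fi_comp h (fi_perm s)).
  by apply: fi_hom_eq => y; rewrite /= !ffunE /= !ffunE /= !ffunE.
by rewrite -(free_map_comp _ cE) -(@free_map_comp _ _ _ _ _ _ c).
Qed.

Definition fi_ind_map S T (f : fi_hom S T) : {linear fi_ind_obj S -> fi_ind_obj T} :=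
  tensor_map (@rep_act k m W) (fi_ind_subproof f).

Fact fi_ind_id S v : fi_ind_map (fi_id S) v = v.
Proof.
rewrite -[v]qpiK [LHS]quotm_mapE; congr (qpi _ _); apply: free_map_id => -[x w] /=.
by rewrite fi_M_id.
Qed.

Fact fi_ind_comp S T Z (g : fi_hom T Z) (f : fi_hom S T) v :
  fi_ind_map (fi_comp g f) v = fi_ind_map g (fi_ind_map f v).
Proof.
rewrite -[v]qpiK [LHS]quotm_mapE [X in _ = _ X]quotm_mapE [RHS]quotm_mapE; congr (qpi _ _); apply: free_map_comp => -[x w] /=.
by rewrite fi_M_comp.
Qed.

Definition fi_ind : fimod k := FIMod fi_ind_id fi_ind_comp.

End Induced.

Definition fi_cover (k : comPzRingType) (I : Type) (m : I -> nat) : fimod k :=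
  fi_dsum (fun i => fi_M k (m i)).

Definition gen_in_degree_le (k : comPzRingType) (V : fimod k) (D : nat) : Prop :=
  exists (I : Type) (m : I -> nat) (p : fimor (fi_cover k m) V),
    fi_surj p /\ forall i, (m i <= D)%N.

Section Filtered.
Variables (k : comPzRingType) (d : nat) (m : 'I_d -> nat).

Definition cover_stage_set (r : nat) S : set (fi_cover k m S) :=
  fun L => forall i : 'I_d, (r <= i)%N -> L i = 0.

Fact cover_stage0 r S : cover_stage_set r (0 : fi_cover k m S).
Proof. by []. Qed.
Fact cover_stageD r S (u v : fi_cover k m S) :
  cover_stage_set r u -> cover_stage_set r v -> cover_stage_set r (u + v).
Proof. by move=> u0 v0 i ri; rewrite /= u0 // v0 // addr0. Qed.
Fact cover_stageZ r S a (u : fi_cover k m S) :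
  cover_stage_set r u -> cover_stage_set r (a *: u).
Proof. by move=> u0 i ri; rewrite /= u0 // scaler0. Qed.
Fact cover_stage_map r S T (f : fi_hom S T) (u : fi_cover k m S) :
  cover_stage_set r u -> cover_stage_set r (fi_map (fi_cover k m) f u).
Proof. by move=> u0 i ri; rewrite /= u0 // linear0. Qed.

(** The sum of the first [r] summands of the cover. *)
Definition cover_stage (r : nat) : fisub (fi_cover k m) :=
  @FISub k (fi_cover k m)
    (fun S => Submod (@cover_stage0 r S) (@cover_stageD r S) (@cover_stageZ r S))
    (@cover_stage_map r).

Variables (V : fimod k) (Pi : fimor (fi_cover k m) V).

Definition stage (r : nat) : fisub V := fi_image Pi (cover_stage r).

(** Summands are numbered from 0: [i : 'I_d] stands for the step [V^(i+1) / V^i]. *)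
Definition sharp_filtration : Prop :=
  fi_surj Pi /\
  forall i : 'I_d, exists W : perm_rep k (m i),
    fi_iso (fi_subquot (stage i.+1) (stage i)) (fi_ind W).

End Filtered.

Definition sharp_filtered (k : comPzRingType) (V : fimod k) : Prop :=
  exists (d : nat) (m : 'I_d -> nat) (Pi : fimor (fi_cover k m) V), sharp_filtration Pi.

(** [tphi] witnesses that [phi] is sequential; [A] and [B] are the subsets of the
    index sets, and [f] is the bijection between them, with inverse [g]. *)
Definition sequential_witness (k : comPzRingType) (d1 d2 : nat)
    (m : 'I_d1 -> nat) (n : 'I_d2 -> nat) (V W : fimod k)
    (Pi1 : fimor (fi_cover k m) V) (Pi2 : fimor (fi_cover k n) W)
    (phi : fimor V W) (tphi : fimor (fi_cover k m) (fi_cover k n)) : Prop :=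
  exists (A : {set 'I_d1}) (B : {set 'I_d2})
         (f : {i | i \in A} -> {j | j \in B}) (g : {j | j \in B} -> {i | i \in A})
         (nm : forall j, n (val j) = m (val (g j))),
    [/\ cancel f g /\ cancel g f,
        forall S (L : fi_cover k m S) j,
          tphi S L (val j) = ecast p (fi_M k p S) (esym (nm j)) (L (val (g j))),
        forall S (L : fi_cover k m S) j, j \notin B -> tphi S L j = 0
      & forall S (L : fi_cover k m S), phi S (Pi1 S L) = Pi2 S (tphi S L)].

(** Exactness of [0 -> A -> J 0 -> J 1 -> ... -> J N -> 0]; only the terms [J i]
    with [i <= N] matter. The map out of [J N] is zero, so its kernel is everything. *)
Definition exact_row (k : comPzRingType) (N : nat) (A : lmodType k)
    (J : nat -> lmodType k) (iota : {linear A -> J 0%N})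
    (phi : forall i, {linear J i -> J i.+1}) : Prop :=
  [/\ injective iota,
      forall y : J 0%N, ((0 < N)%N -> phi 0%N y = 0) <-> (exists x, iota x = y)
    & forall i, (i < N)%N -> forall y : J i.+1,
        ((i.+1 < N)%N -> phi i.+1 y = 0) <-> (exists x, phi i x = y)].

(* Main.v *)
From HB Require Import structures.
Require Import Defs.
From mathcomp Require Import boolp classical_sets cardinality.
From mathcomp Require Import all_boot all_algebra all_fingroup.

Set Implicit Arguments.
Unset Strict Implicit.
Unset Printing Implicit Defensive.

Import GRing.Theory.

(** Everything follows from the shift theorem, proved here in a form that keeps
    track of the cover.

    Let [K] be the kernel of [Pi]. A basis element of the cover on the disjoint
    union of [S] and [[a]] is an injection [h] of some [[m_i]] into it; the pattern
    of [h] records which points of [[m_i]] go to which points of [[a]]. The basis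
    elements with a given pattern span a copy of [M(m')], where [m'] is the number
    of points left free, so the shifted cover is a sum of such summands. Order the
    patterns. The successive quotients of the resulting filtration of [S_{+a}V] are
    the [M(m')/P], with [P] the module of leading terms of the elements of
    [S_{+a}K] for the pattern at hand, and such a quotient is some [M(W)] as soon
    as [P] is generated in degree [m'], which means that restricting a leading
    term to the injections onto one [m']-element subset [R] of [S] again gives a
    leading term, over [R] ([sharp_filtration_of_lead]).

    Restriction to [R] can be achieved at the price of a larger shift: push an
    element of [K] forward along the map that is the identity on [R] and [[a]] and
    moves the points of [S] outside [R] to new points of the shift. If patterns of
    lower degree come first, the terms that meet the new points do not disturb the
    leading term. For the patterns of the highest degree, which leave all points
    free, the leading terms over an [m']-element set form submodules of one fixed
    free module of finite rank that grow with [a], so they stabilize because [k] is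
    Noetherian ([leading_stable]), and from then on restricted leading terms exist
    without any further shift ([sharp_new]). What remains is a sum of summands of
    lower degree, to which the argument applies again; the property survives any
    further shift ([sharp_shift]). After finitely many rounds all patterns are
    settled ([shift_sharp]).

    This gives (A). The same filtration makes every transition map of [S_{+a}V]
    injective ([fi_map_inj_of_lead]), so [V_n -> V_{n+a}] is injective for
    [n >= a] ([fi_unit_inj]).

    For (B), the map from [V] to [S_{+a}V] is covered by the inclusion of the
    summands whose pattern avoids [[a]]. The other summands have smaller degree
    and cover the cokernel, which is therefore generated in degree at most [D - 1].
    Splicing with a resolution of the cokernel, obtained by induction on [D], gives
    the two rows ([sharp_resolution]); each map of the top row projects onto the
    summands that were not hit and includes them into the next cover, hence is a
    coordinate map, which is what sequentiality asks for. *)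

Local Open Scope ring_scope.

(** * Coordinates on covers *)

Lemma dsum_sum (k : comPzRingType) (I : Type) (F : I -> lmodType k) (J : Type)
    (s : seq J) (P : pred J) (f : J -> dsum F) i :
  (\sum_(j <- s | P j) f j) i = \sum_(j <- s | P j) f j i.
Proof. exact: (big_morph (fun u : dsum F => u i)). Qed.

Lemma dsum_subE (k : comPzRingType) (I : Type) (F : I -> lmodType k) (u v : dsum F) i :
  (u - v) i = u i - v i.
Proof. exact: (congr1 _ (scaleN1r (v i))). Qed.

Lemma free_sum (k : comPzRingType) (X : finType) (u : freemod k X) :
  u = \sum_x ((u x : k) *: delta k x : freemod k X).
Proof.
apply: dsumP => y; rewrite dsum_sum (bigD1 y) //= eqxx big1 ?addr0.
  by rewrite /GRing.scale /= mulr1.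
by move=> x; rewrite eq_sym => /negbTE ->; rewrite scaler0.
Qed.

Lemma free_map_sum (k : comPzRingType) (X : finType) (Y : choiceType) (h : X -> Y)
    (u : freemod k X) : free_map k h u = \sum_x ((u x : k) *: delta k (h x) : freemod k Y).
Proof.
rewrite {1}[u]free_sum linear_sum; apply: eq_bigr => x _.
by rewrite linearZ /= free_map_delta.
Qed.

Lemma free_map_val (k : comPzRingType) (X : finType) (Y : choiceType) (h : X -> Y)
    (u : freemod k X) y : free_map k h u y = \sum_(x | h x == y) u x.
Proof.
rewrite free_map_sum dsum_sum [RHS]big_mkcond /=; apply: eq_bigr => x _ /=.
by rewrite eq_sym; case: eqP => _; rewrite /GRing.scale /= ?mulr1 ?mulr0.
Qed.

Fact mkdsum_subproof (k : comPzRingType) (I : finType) (F : I -> lmodType k)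
    (f : forall i, F i) : finite_set [set i | f i <> 0]%classic.
Proof. exact: finite_finset. Qed.

Definition mkdsum (k : comPzRingType) (I : finType) (F : I -> lmodType k)
    (f : forall i, F i) : dsum F := DSum (mkdsum_subproof f).

Definition mkfree (k : comPzRingType) (X : finType) (c : X -> k) : freemod k X :=
  mkdsum (F := fun _ => k^o : lmodType k) c.

Lemma fi_compE (S T U : finType) (g : fi_hom T U) (f : fi_hom S T) s :
  fi_comp g f s = g (f s).
Proof. by rewrite fi_ofE. Qed.

Definition hom_inl (S T : finType) : fi_hom S (S + T)%type := fi_of (@inl_inj S T).
Definition hom_inr (S T : finType) : fi_hom T (S + T)%type := fi_of (@inr_inj S T).

Lemma fi_factor (S T U : finType) (f : fi_hom T U) (h : fi_hom S U) :
  (forall s, exists t, f t = h s) -> exists h1, h = fi_comp f h1.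
Proof.
move=> /choice[g fg].
have gI : injective g by move=> s s' /(congr1 f); rewrite !fg => /fi_hom_inj.
by exists (fi_of gI); apply: fi_hom_eq => s; rewrite fi_compE fi_ofE fg.
Qed.

Lemma fi_compA (S T U Z : finType) (h : fi_hom U Z) (g : fi_hom T U) (f : fi_hom S T) :
  fi_comp h (fi_comp g f) = fi_comp (fi_comp h g) f.
Proof. by apply: fi_hom_eq => s; rewrite !fi_compE. Qed.

Section Coordinates.
Variables (k : comPzRingType) (d : nat) (m : 'I_d -> nat).
Local Notation F := (fi_cover k m).

(** A single index type for the basis of the cover, so that the elements of the
    cover become functions to [k] and the grading by summands becomes data of the
    index. *)
Definition basis (X : finType) := {i : 'I_d & fi_hom 'I_(m i) X}.
HB.instance Definition _ X := Finite.on (basis X).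

Definition bas X (i : 'I_d) (h : fi_hom 'I_(m i) X) : basis X :=
  Tagged (fun i => fi_hom 'I_(m i) X) h.

Definition bcoef X (x : F X) (b : basis X) : k := x (tag b) (tagged b).

Lemma bcoefP X (x y : F X) : (forall b, bcoef x b = bcoef y b) -> x = y.
Proof.
by move=> xy; apply: dsumP => i; apply: dsumP => h; exact: (xy (bas h)).
Qed.

Lemma bcoef0 X b : bcoef (0 : F X) b = 0. Proof. by []. Qed.
Lemma bcoefD X (x y : F X) b : bcoef (x + y) b = bcoef x b + bcoef y b. Proof. by []. Qed.
Lemma bcoefZ X a (x : F X) b : bcoef (a *: x) b = a * bcoef x b. Proof. by []. Qed.

Definition bmap X Y (f : fi_hom X Y) (b : basis X) : basis Y :=
  bas (fi_comp f (tagged b)).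

Lemma bmap_comp X Y Z (g : fi_hom Y Z) (f : fi_hom X Y) b :
  bmap g (bmap f b) = bmap (fi_comp g f) b.
Proof. by rewrite /bmap /= fi_compA. Qed.

Lemma fi_comp_inj (S T U : finType) (f : fi_hom T U) : injective (@fi_comp S T U f).
Proof.
move=> g h /(congr1 (@fi_fun _ _)) /ffunP fgh; apply: fi_hom_eq => s.
by have := fgh s; rewrite !ffunE /= => /fi_hom_inj.
Qed.

Lemma bcoef_push X Y (f : fi_hom X Y) (x : F X) b :
  bcoef (fi_map F f x) (bmap f b) = bcoef x b.
Proof.
rewrite /bcoef /= free_map_val (eq_bigl (pred1 (tagged b))) ?big_pred1_eq //.
by move=> h /=; apply: inj_eq; apply: fi_comp_inj.
Qed.

Lemma bcoef_push_neq0 X Y (f : fi_hom X Y) (x : F X) b :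
  bcoef (fi_map F f x) b != 0 -> exists2 b0, b = bmap f b0 & bcoef x b0 != 0.
Proof.
case: b => i h; rewrite /bcoef /= free_map_val => nz.
have [h0 /eqP hh0 xh0] : exists2 h0, fi_comp f h0 == h & x i h0 != 0.
  apply: contrapT => nex; case/eqP: nz; apply: big1 => h0 fh0.
  by apply/eqP; apply: contrapT => /negP ne; apply: nex; exists h0.
by exists (bas h0) => //; rewrite /bmap /= hh0.
Qed.

Definition mkcov X (c : basis X -> k) : F X :=
  mkdsum (F := fun i => fi_M k (m i) X) (fun i => mkfree (fun h => c (bas h))).

Lemma bcoef_mkcov X (c : basis X -> k) b : bcoef (mkcov c) b = c b.
Proof. by case: b. Qed.

End Coordinates.

(** * Chains of submodules over a Noetherian ring *)

Lemma submodB (k : comPzRingType) (M : lmodType k) (N : submod M) u v :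
  N u -> N v -> N (u - v).
Proof. by move=> Nu Nv; rewrite -scaleN1r; apply: submodD => //; apply: submodZ. Qed.

Section NoetherianChain.
Variables (k : comPzRingType) (X : finType).
Local Notation M := (freemod k X).

Section Ideal.
Variables (N : nat -> submod M) (x : X).
Hypothesis N_incr : forall i j, (i <= j)%N -> forall u, N i u -> N j u.

Definition coord_ideal_set (a : (k^o : lmodType k)) : Prop :=
  exists i, exists2 u, N i u & u x = a.

Fact coord_ideal0 : coord_ideal_set 0.
Proof. by exists 0%N, 0 => //; apply: submod0. Qed.
Fact coord_idealD a b : coord_ideal_set a -> coord_ideal_set b -> coord_ideal_set (a + b).
Proof.
move=> [i [u Nu <-]] [j [v Nv <-]]; exists (maxn i j), (u + v) => //.
apply: submodD; [apply: N_incr Nu|apply: N_incr Nv]; [exact: leq_maxl|exact: leq_maxr].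
Qed.
Fact coord_idealZ c a : coord_ideal_set a -> coord_ideal_set (c *: a).
Proof. by move=> [i [u Nu <-]]; exists i, (c *: u) => //; apply: submodZ. Qed.

Definition coord_ideal : submod (k^o : lmodType k) :=
  Submod coord_ideal0 coord_idealD coord_idealZ.

Fact coord_kernel0 i : N i 0 /\ (0 : M) x = 0.
Proof. by split=> //; apply: submod0. Qed.
Fact coord_kernelD i u v : N i u /\ u x = 0 -> N i v /\ v x = 0 -> N i (u + v) /\ (u + v) x = 0.
Proof. by move=> [Nu u0] [Nv v0]; split; [apply: submodD|rewrite /= u0 v0 addr0]. Qed.
Fact coord_kernelZ i c u : N i u /\ u x = 0 -> N i (c *: u) /\ (c *: u) x = 0.
Proof. by move=> [Nu u0]; split; [apply: submodZ|rewrite /= u0 scaler0]. Qed.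

Definition coord_kernel i : submod M :=
  Submod (@coord_kernel0 i) (@coord_kernelD i) (@coord_kernelZ i).

(** The values at [x] of the members of the chain form an increasing chain of
    ideals, and its union is finitely generated. *)
Lemma coord_ideal_stable : noetherian k -> exists i0, forall i u, N i u ->
  exists2 v, N i0 v & v x = u x.
Proof.
move=> /(_ coord_ideal)[t tP].
have [i0 i0P] : exists i0, forall a, a \in t -> exists2 v, N i0 v & v x = a.
  have tI : forall a, a \in t -> coord_ideal a.
    by move=> a ta; apply/tP => J; apply.
  elim: t tI {tP} => [|a t IH] tI; first by exists 0%N.
  have [b tb|i1 i1P] := IH; first by apply: tI; rewrite inE tb orbT.
  have [i2 [v Nv va]] := tI a (mem_head _ _).
  exists (maxn i1 i2) => b; rewrite inE => /orP[/eqP->|/i1P[w Nw <-]].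
    by exists v => //; apply: N_incr Nv; apply: leq_maxr.
  by exists w => //; apply: N_incr Nw; apply: leq_maxl.
exists i0 => i u Nu.
have /tP : coord_ideal (u x) by exists i, u.
have S0 : exists2 v, N i0 v & v x = 0 by exists 0 => //; apply: submod0.
have SD a b : (exists2 v, N i0 v & v x = a) -> (exists2 v, N i0 v & v x = b) ->
    exists2 v, N i0 v & v x = a + b.
  by move=> [v Nv <-] [w Nw <-]; exists (v + w) => //; apply: submodD.
have SZ c (a : k^o) : (exists2 v, N i0 v & v x = a) -> exists2 v, N i0 v & v x = c *: a.
  by move=> [v Nv <-]; exists (c *: v) => //; apply: submodZ.
by move/(_ (Submod S0 SD SZ)); apply.
Qed.

End Ideal.

(** Finite free modules over a Noetherian ring are Noetherian. The induction is on
    the set of coordinates that may be nonzero: an element of a late member differs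
    from one of an early member by an element vanishing at one more coordinate. *)
Lemma noetherian_chain (N : nat -> submod M) :
  noetherian k -> (forall i j, (i <= j)%N -> forall u, N i u -> N j u) ->
  exists i0, forall i u, N i u -> N i0 u.
Proof.
move=> k_noeth.
have: forall i u, N i u -> forall x, x \notin enum X -> u x = 0.
  by move=> i u _ x; rewrite mem_enum.
elim: (enum X) N => [|x s IH] N Ns N_incr.
  exists 0%N => i u /Ns u0; have -> : u = 0 by apply: dsumP => x; apply: u0.
  exact: submod0.
have [i1 i1P] := coord_ideal_stable x N_incr k_noeth.
have [||i2 i2P] := IH (coord_kernel N x).
- move=> i u /= [Nu ux0] y ys; have [->//|yx] := eqVneq y x.
  by apply: (Ns i) => //; rewrite inE negb_or yx.
- by move=> i j ij u /= [Nu ux0]; split=> //; apply: N_incr Nu.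
exists (maxn i1 i2) => i u Nu; have [v Nv vx] := i1P i u Nu.
have [|Nuv _] := i2P (maxn i i1) (u - v); first split.
- by apply: submodB; [apply: N_incr Nu|apply: N_incr Nv]; [exact: leq_maxl|exact: leq_maxr].
- by rewrite /= vx scaleN1r subrr.
rewrite -(subrK v u); apply: submodD; [apply: N_incr Nuv|apply: N_incr Nv].
  exact: leq_maxr.
exact: leq_maxl.
Qed.

End NoetherianChain.

(** * Trace patterns and leading terms *)

Lemma card_fi_hom_img (A X : finType) (al : fi_hom A X) : #|al @: [set: A]| = #|A|.
Proof. by rewrite card_imset ?cardsT //; exact: fi_hom_inj. Qed.

Section Classes.
Variables (d : nat) (m : 'I_d -> nat).

(** Shifts are handled through finite sets under a fixed finite set [A], that is
    through injections from [A] to [X], where [X] plays the role of the disjoint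
    union of [A] and the set on which the shifted module is evaluated. Then shifting
    once more only means composing with an injection from [A] to a larger set, and
    no reassociation of disjoint unions occurs. *)
Definition pattern (A : finType) := {i : 'I_d & {ffun 'I_(m i) -> option A}}.
HB.instance Definition _ A := Finite.on (pattern A).

Definition mkpattern (A : finType) (i : 'I_d) (g : {ffun 'I_(m i) -> option A}) : pattern A :=
  Tagged (fun i => {ffun 'I_(m i) -> option A}) g.

Definition pat (A X : finType) (al : fi_hom A X) (b : basis m X) : pattern A :=
  mkpattern [ffun j => [pick a | al a == tagged b j]].

Definition pdeg (A : finType) (c : pattern A) : nat := #|[set j | tagged c j == None]|.

Definition bimg (X : finType) (b : basis m X) : {set X} := tagged b @: [set: 'I_(m (tag b))].

Definition prestr (A A' : finType) (io : fi_hom A A') (c : pattern A') : pattern A :=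
  mkpattern [ffun j => if tagged c j is Some a' then [pick a | io a == a'] else None].

(** The pattern on [A'] with the given trace on [A] and no other value in [A']. *)
Definition pext (A A' : finType) (io : fi_hom A A') (c : pattern A) : pattern A' :=
  mkpattern [ffun j => omap io (tagged c j)].

Lemma pat_Some A X (al : fi_hom A X) b j a :
  (tagged (pat al b) j == Some a) = (al a == tagged b j).
Proof.
rewrite /= ffunE; case: pickP => [a' /eqP Ea'|/(_ a) -> //].
apply/eqP/eqP => [[<-] //|]; by rewrite -Ea' => /fi_hom_inj ->.
Qed.

Lemma pat_None A X (al : fi_hom A X) b j :
  (tagged (pat al b) j == None) = (tagged b j \notin al @: [set: A]).
Proof.
apply/eqP/idP => [E|nE].
  apply/imsetP => -[a _ Ea]; move: E; rewrite /= ffunE Ea.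
  by case: pickP => // /(_ a); rewrite eqxx.
rewrite /= ffunE; case: pickP => // a /eqP E.
by case/negP: nE; rewrite -E imset_f.
Qed.

Lemma pat_bmap A X Y (f : fi_hom X Y) (al : fi_hom A X) b :
  pat (fi_comp f al) (bmap f b) = pat al b.
Proof.
congr mkpattern; apply/ffunP => j; rewrite !ffunE; apply: eq_pick => a /=.
by rewrite !fi_compE (inj_eq (@fi_hom_inj _ _ f)).
Qed.

Lemma pat_prestr A A' X (io : fi_hom A A') (al : fi_hom A' X) b :
  pat (fi_comp al io) b = prestr io (pat al b).
Proof.
congr mkpattern; apply/ffunP => j; rewrite !ffunE.
case: (pickP (fun a => al a == tagged b j)) => [a' /eqP Ea'|na].
  by apply: eq_pick => a; rewrite /= fi_compE -Ea' (inj_eq (@fi_hom_inj _ _ al)).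
by case: pickP => // a; rewrite /= fi_compE na.
Qed.

Lemma pdeg_pat A X (al : fi_hom A X) b :
  pdeg (pat al b) = #|bimg b :\: al @: [set: A]|.
Proof.
rewrite /pdeg -(card_imset _ (@fi_hom_inj _ _ (tagged b))); congr #|pred_of_set _|.
apply/setP => z; apply/imsetP/setDP => [[j]|[/imsetP[j _ ->] nj]].
  by rewrite inE pat_None => nj ->; split=> //; apply: imset_f.
by exists j => //; rewrite inE pat_None.
Qed.

Lemma mem_bimg_pat A X (al : fi_hom A X) b a :
  (al a \in bimg b) = [exists j, tagged (pat al b) j == Some a].
Proof.
apply/imsetP/existsP => [[j _ E]|[j]]; first by exists j; rewrite pat_Some E.
by rewrite pat_Some => /eqP E; exists j.
Qed.

Lemma prestr_None A A' (io : fi_hom A A') (c : pattern A') :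
  [set j | tagged c j == None] \subset
  [set j : 'I_(m (tag c)) | tagged (prestr io c) j == None].
Proof. by apply/subsetP => j; rewrite !inE /= ffunE => /eqP ->. Qed.

Lemma pdeg_prestr A A' (io : fi_hom A A') (c : pattern A') : (pdeg c <= pdeg (prestr io c))%N.
Proof. exact: subset_leq_card (prestr_None io c). Qed.

(** Equal degrees mean that no point takes a value outside [A]. *)
Lemma pext_prestr A A' (io : fi_hom A A') (c : pattern A') :
  pdeg (prestr io c) = pdeg c -> c = pext io (prestr io c).
Proof.
move=> E; have /eqP S : [set j | tagged c j == None] ==
    [set j : 'I_(m (tag c)) | tagged (prestr io c) j == None].
  by rewrite eqEcard prestr_None /= -[X in (_ <= X)%N]/(pdeg c) -E.
case: c E S => i g _ S; congr mkpattern; apply/ffunP => j; rewrite !ffunE /= ?ffunE.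
move/setP: S => /(_ j); rewrite !inE /= ffunE.
by case: (g j) => // a'; case: pickP => [a /eqP <-|_ /eqP].
Qed.

Lemma pext_Some A A' (io : fi_hom A A') (c : pattern A) j a' :
  tagged (pext io c) j == Some a' -> exists a, io a = a'.
Proof. by case: c j => i g j; rewrite /= ffunE; case: (g j) => //= a /eqP[<-]; exists a. Qed.

Lemma bmap_factor X Y (f : fi_hom X Y) (b : basis m Y) :
  (forall z, z \in bimg b -> exists x, f x = z) -> exists b1, b = bmap f b1.
Proof.
case: b => i h fz; have [j|h1 hE] := @fi_factor _ _ _ f h.
  by apply: fz; apply: imset_f.
by exists (bas h1); rewrite hE.
Qed.

Lemma bimg_bmap X Y (f : fi_hom X Y) (b : basis m X) : bimg (bmap f b) = f @: bimg b.
Proof. by rewrite /bimg -imset_comp; apply: eq_imset => j; rewrite /= fi_compE. Qed.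

(** By counting: [X] has just enough points outside [A] for the free points of the
    pattern. *)
Lemma bimg_full A X (al : fi_hom A X) b :
  #|X| = (pdeg (pat al b) + #|A|)%N -> forall z, z \notin al @: [set: A] -> z \in bimg b.
Proof.
move=> cX z nz; have S : bimg b :\: al @: [set: A] = ~: (al @: [set: A]).
  apply/eqP; rewrite eqEcard; apply/andP; split; first by rewrite setDE subsetIr.
  by rewrite -pdeg_pat cardsCs setCK card_fi_hom_img cX addnK.
have : z \in ~: (al @: [set: A]) by rewrite inE.
by rewrite -S => /setDP[].
Qed.

End Classes.

Section Sharp.
Variables (k : comPzRingType) (d : nat) (m : 'I_d -> nat) (K : fisub (fi_cover k m)).
Local Notation F := (fi_cover k m).

(** The leading term at [c] of an element of [K] over [X], restricted to the
    injections that factor through [X0], is the leading term at [c] of an element of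
    [K] over [X0]. As [X0] has [pdeg c] points outside [A], this says that the
    leading terms at [c] are generated in degree [pdeg c]. *)
Definition sharp (A : finType) (rho : pattern m A -> nat) (c : pattern m A) : Prop :=
  forall (X0 X : finType) (al : fi_hom A X0) (e : fi_hom X0 X),
    #|X0| = (pdeg c + #|A|)%N ->
    forall x : F X, K X x ->
      (forall b, bcoef x b != 0 -> (rho (pat (fi_comp e al) b) <= rho c)%N) ->
    exists y : F X0, [/\ K X0 y,
      forall b, bcoef y b != 0 -> (rho (pat al b) <= rho c)%N
    & forall b, pat al b = c -> bcoef y b = bcoef x (bmap e b)].

(** Sharpness survives a larger shift. An element that is leading at [c] for [A'] has
    its leading term for [A] at the trace of [c], and sharpness for [A] may be
    applied to the subset of [X0] formed by [A] and the points hit by a basis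
    element of pattern [c]: all such basis elements have the same image. The
    hypotheses on [rho'] say that it refines the order that [rho] induces on
    traces, as far as [c] is concerned. *)
Lemma sharp_shift (A A' : finType) (io : fi_hom A A') (rho : pattern m A -> nat)
    (rho' : pattern m A' -> nat) (c : pattern m A') :
  injective rho -> sharp rho (prestr io c) ->
  (forall c1, (rho' c1 <= rho' c)%N -> (rho (prestr io c1) <= rho (prestr io c))%N) ->
  (forall c1, (rho (prestr io c1) < rho (prestr io c))%N -> (rho' c1 <= rho' c)%N) ->
  sharp rho' c.
Proof.
move=> rhoI sh le' lt' X0 X al e cX0 x Kx xs.
(* if no basis element over X0 has pattern c, there is no leading term to find *)
have [[b0 b0c]|nb] := pselect (exists b0, pat al b0 = c); last first.
  exists 0; split; first exact: submod0.
    by move=> b; rewrite bcoef0 eqxx.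
  by move=> b bc; case: nb; exists b.
pose S := bimg b0 :|: fi_comp al io @: [set: A].
pose X1 : finType := {z | z \in S}.
pose i : fi_hom X1 X0 := fi_of (@val_inj _ _ X1).
have iE z : i z = val z by exact: fi_ofE.
have [a|al1 al1E] := @fi_factor _ _ _ i (fi_comp al io).
  have aS : fi_comp al io a \in S by rewrite inE imset_f ?orbT.
  by exists (exist (fun z => z \in S) _ aS); rewrite iE.
have cX1 : #|X1| = (pdeg (prestr io c) + #|A|)%N.
  rewrite card_sig -b0c -pat_prestr pdeg_pat -(card_fi_hom_img (fi_comp al io)).
  rewrite -cardsUI [X in (_ + X)%N](_ : _ = 0%N) ?addn0; last first.
    by apply/eqP; rewrite cards_eq0 setDE -setIA [~: _ :&: _]setIC setICr setI0.
  by rewrite setDE setUIl [~: _ :|: _]setUC setUCr setIT; apply: eq_card.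
have tr1 b1 : pat al1 b1 = prestr io (pat al (bmap i b1)).
  by rewrite -pat_prestr al1E pat_bmap.
have [|y1 [Ky1 y1s y1c]] := sh X1 X al1 (fi_comp e i) cX1 x Kx.
  by move=> b xb; rewrite -fi_compA -al1E fi_compA pat_prestr; apply/le'/xs.
exists (fi_map F i y1); split.
- exact: fisub_map.
- move=> b /bcoef_push_neq0[b1 -> y1b1].
  have := y1s b1 y1b1; rewrite leq_eqVlt tr1 => /orP[/eqP/rhoI E|]; last exact: lt'.
  rewrite -(pat_bmap e); apply: xs; rewrite bmap_comp -y1c //.
  by rewrite tr1.
- move=> b bc.
  have [z zb|b1 bE] := @bmap_factor _ _ _ _ i b.
    have zS : z \in S.
      rewrite inE; apply/orP; left; have [/imsetP[a _ zE]|nz] := boolP (z \in al @: [set: A']).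
        by move: zb; rewrite zE !mem_bimg_pat bc b0c.
      by apply: bimg_full nz; rewrite b0c.
    by exists (exist (fun z => z \in S) _ zS); rewrite iE.
  by rewrite bE bcoef_push y1c ?bmap_comp // tr1 -bE bc.
Qed.

(** One round of the settling of patterns. [G] holds those already settled; the
    others have degree at most [e], and those of degree exactly [e] come next. *)
Section Chain.
Variables (A : finType) (G : pred (pattern m A)) (e : nat).
Hypothesis G_deg : forall c, ~~ G c -> (pdeg c <= e)%N.
Local Notation W0 := ('I_e + A)%type.

Definition hits (Z : finType) (ze : fi_hom W0 Z) (b : basis m Z) : nat :=
  #|bimg b :&: fi_comp ze (hom_inl 'I_e A) @: [set: 'I_e]|.

(** The terms allowed in an element whose leading pattern is [c], for the order that
    has the settled patterns on top, below them the basis elements hitting all [e]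
    standard points, ordered by their traces on [A], and then everything else. *)
Definition low (c : pattern m A) (Z : finType) (ze : fi_hom W0 Z) (b : basis m Z) : Prop :=
  ~~ G (pat (fi_comp ze (hom_inr 'I_e A)) b) /\
  (hits ze b = e ->
    (enum_rank (pat (fi_comp ze (hom_inr 'I_e A)) b) <= enum_rank c)%N).

Section Leading.
Variables (c : pattern m A) (Z : finType) (ze : fi_hom W0 Z).

(** The coordinates of [u] outside the pattern [c] are left unconstrained: this makes
    the ambient module independent of [c]. *)
Definition leading_set (u : freemod k (basis m W0)) : Prop :=
  exists y : F Z, [/\ K Z y, forall b, bcoef y b != 0 -> low c ze b
    & forall b, pat (hom_inr 'I_e A) b = c -> bcoef y (bmap ze b) = u b].

Fact leading0 : leading_set 0.
Proof.
exists 0; split=> //; first exact: submod0.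
by move=> b; rewrite bcoef0 eqxx.
Qed.
Fact leadingD u v : leading_set u -> leading_set v -> leading_set (u + v).
Proof.
move=> [y [Ky ys yu]] [z [Kz zs zv]]; exists (y + z); split; first exact: submodD.
  move=> b; rewrite bcoefD; have [->|/ys //] := eqVneq (bcoef y b) 0.
  by rewrite add0r => /zs.
by move=> b bc; rewrite bcoefD yu // zv.
Qed.
Fact leadingZ a u : leading_set u -> leading_set (a *: u).
Proof.
move=> [y [Ky ys yu]]; exists (a *: y); split; first exact: submodZ.
  move=> b; rewrite bcoefZ; have [->|/ys //] := eqVneq (bcoef y b) 0.
  by rewrite mulr0 eqxx.
by move=> b bc; rewrite bcoefZ yu.
Qed.
Definition leading : submod (freemod k (basis m W0)) :=
  Submod leading0 leadingD leadingZ.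

End Leading.

Lemma leading_push c (Z Z' : finType) (ze : fi_hom W0 Z) (f : fi_hom Z Z') u :
  leading c ze u -> leading c (fi_comp f ze) u.
Proof.
move=> [y [Ky ys yu]]; exists (fi_map F f y); split; first exact: fisub_map.
  move=> b /bcoef_push_neq0[b1 -> /ys[nG le]]; split; rewrite -fi_compA pat_bmap //.
  move=> he; apply: le; rewrite -he /hits bimg_bmap -fi_compA.
  have -> : fi_comp f (fi_comp ze (hom_inl 'I_e A)) @: [set: 'I_e] =
      f @: (fi_comp ze (hom_inl 'I_e A) @: [set: 'I_e]).
    by rewrite -imset_comp; apply: eq_imset => r; rewrite fi_compE.
  by rewrite -imsetI ?card_imset //; [exact: fi_hom_inj|move=> ? ? _ _; exact: fi_hom_inj].
by move=> b bc; rewrite -bmap_comp bcoef_push yu.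
Qed.

Lemma hom_inl_extend (W Z : finType) (ze : fi_hom W Z) :
  exists f : fi_hom Z (W + 'I_#|Z|)%type, fi_comp f ze = hom_inl W 'I_#|Z|.
Proof.
pose f z : (W + 'I_#|Z|)%type :=
  if [pick w | ze w == z] is Some w then inl w else inr (enum_rank z).
have fI : injective f.
  move=> z z'; rewrite /f; case: pickP => [w /eqP <-|_]; case: pickP => [w' /eqP <-|_] //.
    by move=> [->].
  by move=> [/enum_rank_inj].
exists (fi_of fI); apply: fi_hom_eq => w; rewrite fi_compE !fi_ofE /f.
by case: pickP => [w' /eqP/fi_hom_inj ->//|/(_ w)]; rewrite eqxx.
Qed.

(** The leading terms of degree [e] grow with the ambient set [Z] inside a fixed
    finite free module, so all of them already occur over one standard set. *)
Lemma leading_stable : noetherian k -> exists b0, forall c (Z : finType) (ze : fi_hom W0 Z) u,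
  leading c ze u -> leading c (hom_inl W0 'I_b0) u.
Proof.
move=> k_noeth.
have widen i j (ij : (i <= j)%N) : exists f : fi_hom (W0 + 'I_i)%type (W0 + 'I_j)%type,
    fi_comp f (hom_inl W0 'I_i) = hom_inl W0 'I_j.
  pose f (z : W0 + 'I_i) : (W0 + 'I_j)%type :=
    match z with inl w => inl w | inr t => inr (widen_ord ij t) end.
  have fI : injective f.
    by move=> [w|t] [w'|t'] //= [] => [->//|] E; congr inr; apply/val_inj.
  by exists (fi_of fI); apply: fi_hom_eq => w; rewrite fi_compE !fi_ofE.
have incr c i j : (i <= j)%N -> forall u,
    leading c (hom_inl W0 'I_i) u -> leading c (hom_inl W0 'I_j) u.
  by move=> /widen[f <-] u; apply: leading_push.
have /choice[g gP] c := noetherian_chain (N := fun i => leading c (hom_inl W0 'I_i))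
  k_noeth (incr c).
exists (\max_c g c)%N => c Z ze u uP.
apply: (incr c (g c)); first exact: leq_bigmax.
by apply: (gP c #|Z|); have [f <-] := hom_inl_extend ze; apply: leading_push.
Qed.

Section Step.
Variable b0 : nat.
Hypothesis stable : forall c (Z : finType) (ze : fi_hom W0 Z) u,
  leading c ze u -> leading c (hom_inl W0 'I_b0) u.
Local Notation A' := (A + 'I_b0)%type.
Local Notation io := (hom_inl A 'I_b0).
Variable rho' : pattern m A' -> nat.

(** Over a shift by at least [A + 'I_b0], the patterns of degree [e] that avoid
    ['I_b0] are sharp: a restricted leading term lies in [leading] for the set [X]
    itself, viewed under [W0] through [X0], hence by stability in [leading] for
    [W0 + 'I_b0], which maps to [X0]. *)
Lemma sharp_new (c : pattern m A') :
  ~~ G (prestr io c) -> pdeg c = e ->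
  (forall c1, (rho' c1 <= rho' c)%N <->
    ~~ G (prestr io c1) /\
    (pdeg c1 = e -> (enum_rank (prestr io c1) <= enum_rank (prestr io c))%N)) ->
  sharp rho' c.
Proof.
move=> nG dc rP X0 X al f; rewrite dc => cX0 x Kx xs.
have dres : pdeg (prestr io c) = e.
  by apply/eqP; rewrite eqn_leq G_deg //= -[X in (X <= _)%N]dc pdeg_prestr.
have cC : #|~: (al @: [set: A'])| = e.
  by rewrite cardsCs setCK card_fi_hom_img cX0 addnK.
(* the points of X0 outside the shift, numbered *)
have [ka [kaP kaF]] : exists ka : fi_hom 'I_e X0,
    (forall r, ka r \notin al @: [set: A']) /\
    (forall z, z \notin al @: [set: A'] -> exists r, ka r = z).
  have kaI : injective (fun r : 'I_e => enum_val (cast_ord (esym cC) r)).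
    by move=> r r' /enum_val_inj /cast_ord_inj.
  exists (fi_of kaI); split=> [r|z nz].
    by rewrite fi_ofE; have := enum_valP (cast_ord (esym cC) r); rewrite inE.
  have zC : z \in ~: (al @: [set: A']) by rewrite inE.
  by exists (cast_ord cC (enum_rank_in zC z)); rewrite fi_ofE cast_ordK enum_rankK_in.
have kaal r a : ka r <> al a by move=> E; have := kaP r; rewrite E imset_f.
have zeI : injective (fun w : W0 => match w with inl r => ka r | inr a => al (inl a) end).
  move=> [r|a] [r'|a'] => [/fi_hom_inj ->//|/kaal//|/esym/kaal//|/fi_hom_inj [->//]].
pose ze := fi_of zeI.
have f0I : injective (fun w : W0 + 'I_b0 => match w with inl w => ze w | inr t => al (inr t) end).
  move=> [w|t] [w'|t'] => [/fi_hom_inj ->//||| /fi_hom_inj[->]//]; rewrite fi_ofE.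
    by case: w => [r /kaal|a /fi_hom_inj].
  by case: w' => [r /esym/kaal|a /fi_hom_inj].
have f0E : fi_comp (fi_of f0I) (hom_inl W0 'I_b0) = ze.
  by apply: fi_hom_eq => w; rewrite fi_compE !fi_ofE.
have zeA : fi_comp ze (hom_inr 'I_e A) = fi_comp al io.
  by apply: fi_hom_eq => a; rewrite !fi_compE !fi_ofE.
have zeR : fi_comp ze (hom_inl 'I_e A) = ka.
  by apply: fi_hom_eq => r; rewrite !fi_compE !fi_ofE.
pose u : freemod k (basis m W0) := mkfree (fun b => bcoef x (bmap (fi_comp f ze) b)).
have : leading (prestr io c) (fi_comp f ze) u.
  exists x; split=> // b /xs/rP[nGb le]; split; rewrite -fi_compA zeA fi_compA pat_prestr //.
  move=> hb; apply: le; apply/eqP; rewrite eqn_leq; apply/andP; split.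
    exact: leq_trans (pdeg_prestr _ _) (G_deg nGb).
  rewrite -[X in (X <= _)%N]hb pdeg_pat; apply: subset_leq_card; apply/subsetP => z.
  rewrite -fi_compA zeR => /setIP[zb /imsetP[r _ zE]]; rewrite inE zb andbT.
  by apply/imsetP => -[a _]; rewrite zE !fi_compE => /fi_hom_inj/kaal.
move=> /stable/(leading_push (fi_of f0I)); rewrite f0E => -[y [Ky ys yu]].
exists y; split=> // b.
  move=> /ys[]; rewrite /low zeA pat_prestr => nGb le; apply/rP; split=> // db; apply: le.
  rewrite /hits zeR; have /setIidPr -> : ka @: [set: 'I_e] \subset bimg b.
    apply/subsetP => _ /imsetP[r _ ->]; apply: bimg_full (kaP r).
    by rewrite db.
  by rewrite card_fi_hom_img card_ord.
move=> bc; have [z zb|b1 bE] := @bmap_factor _ _ _ _ ze b.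
  have [/imsetP[a _ zE]|/kaF[r <-]] := boolP (z \in al @: [set: A']); last first.
    by exists (inl r); rewrite fi_ofE.
  move: zb; rewrite zE mem_bimg_pat bc (pext_prestr (io := io) (c := c)) ?dres //.
  case/existsP => j /pext_Some[a1 <-].
  by exists (inr a1); rewrite !fi_ofE.
rewrite bE yu ?bmap_comp //.
by rewrite -bc -pat_prestr -zeA bE pat_bmap.
Qed.

End Step.
End Chain.

(** Ties of [base] are broken by an arbitrary enumeration. *)
Definition lexcode (T : finType) (base : T -> nat) (t : T) : nat :=
  (base t * #|T| + enum_rank t)%N.

Lemma lexcode_lt (T : finType) (base : T -> nat) t1 t2 :
  (base t1 < base t2)%N -> (lexcode base t1 < lexcode base t2)%N.
Proof.
move=> lt; rewrite /lexcode; apply: (@leq_trans (base t1 * #|T| + #|T|)%N).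
  by rewrite ltn_add2l.
by rewrite -mulSnr; apply: leq_trans (leq_addr _ _); rewrite leq_mul2r lt orbT.
Qed.

Lemma lexcode_le (T : finType) (base : T -> nat) t1 t2 :
  (lexcode base t1 <= lexcode base t2)%N -> (base t1 <= base t2)%N.
Proof. by rewrite leqNgt; apply: contraNleq => /lexcode_lt. Qed.

Lemma lexcode_inj (T : finType) (base : T -> nat) : injective (lexcode base).
Proof.
move=> t1 t2 E; have E2 : base t1 = base t2.
  by apply/eqP; rewrite eqn_leq !(@lexcode_le _ base) ?E.
by move: E; rewrite /lexcode E2 => /addnI/val_inj/enum_rank_inj.
Qed.

(** [G] holds the settled patterns. Besides all patterns of degree at least [e] it
    contains patterns of lower degree, namely those whose trace on an earlier,
    smaller shift was settled: they stay above the unsettled ones, so that the order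
    on [G] refines the earlier order. *)
Definition sharp_above (e : nat) : Prop :=
  exists (A : finType) (rho : pattern m A -> nat) (G : pred (pattern m A)),
  [/\ injective rho, forall c, G c -> sharp rho c,
      forall c1 c2, ~~ G c1 -> G c2 -> (rho c1 < rho c2)%N
    & forall c, ~~ G c -> (pdeg c < e)%N].

(** The new order has three layers: the patterns whose trace on [A] was settled,
    ordered by that trace; the patterns of degree [e] among the others, which avoid
    the new points ['I_b0] and are ordered by their trace; everything else. *)
Lemma sharp_above_step e : noetherian k -> sharp_above e.+1 -> sharp_above e.
Proof.
move=> k_noeth [A [rho [G [rhoI shG ltG degG]]]].
have [b0 stab] := leading_stable G e k_noeth.
pose A' : finType := (A + 'I_b0)%type; pose io : fi_hom A A' := hom_inl A 'I_b0.
pose base (c : pattern m A') : nat :=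
  if G (prestr io c) then (#|{: pattern m A}| + 1 + rho (prestr io c))%N
  else if pdeg c == e then (enum_rank (prestr io c)).+1 else 0%N.
exists A', (lexcode base), [pred c | G (prestr io c) || (pdeg c == e)].
have base_low c : ~~ G (prestr io c) -> (base c <= #|{: pattern m A}|)%N.
  by rewrite /base => /negbTE ->; case: eqP => _ //; apply: ltn_ord.
have base_high c : G (prestr io c) -> (#|{: pattern m A}| < base c)%N.
  by rewrite /base => ->; rewrite addn1 ltnS leq_addr.
split.
- exact: lexcode_inj.
- move=> c /=; have [Gc _|nGc /= /eqP dc] := boolP (G (prestr io c)).
    apply: (sharp_shift rhoI (shG _ Gc)) => c1.
      move/lexcode_le; have [Gc1|nGc1] := boolP (G (prestr io c1)).
        by rewrite /base Gc Gc1 leq_add2l.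
      by move=> _; apply/ltnW/ltG.
    move=> lt; apply/ltnW/lexcode_lt; have [Gc1|nGc1] := boolP (G (prestr io c1)).
      by rewrite /base Gc Gc1 ltn_add2l.
    by apply: leq_ltn_trans (base_low _ nGc1) (base_high _ Gc).
  apply: (sharp_new degG stab nGc dc) => c1; split.
    move=> /lexcode_le le; have nGc1 : ~~ G (prestr io c1).
      apply/negP => /base_high; rewrite ltnNge => /negP; apply.
      by apply: leq_trans le _; apply: base_low.
    split=> // dc1; move: le.
    by rewrite /base (negbTE nGc) (negbTE nGc1) dc dc1 eqxx ltnS.
  move=> [nGc1 le]; have [dc1|dc1] := eqVneq (pdeg c1) e; last first.
    by apply/ltnW/lexcode_lt; rewrite /base (negbTE nGc) (negbTE nGc1) dc eqxx (negbTE dc1).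
  move: (le dc1); rewrite leq_eqVlt => /orP[/eqP/val_inj/enum_rank_inj E|lt].
    have extE c2 : ~~ G (prestr io c2) -> pdeg c2 = e -> c2 = pext io (prestr io c2).
      move=> nG2 d2; apply: pext_prestr; apply/eqP; rewrite eqn_leq pdeg_prestr andbT d2.
      exact: degG.
    by rewrite (extE _ nGc1 dc1) (extE _ nGc dc) E.
  by apply/ltnW/lexcode_lt; rewrite /base (negbTE nGc) (negbTE nGc1) dc dc1 eqxx ltnS.
- move=> c1 c2; rewrite /= negb_or => /andP[nG1 d1].
  move=> G2; apply: lexcode_lt; rewrite [base c1]/base (negbTE nG1) (negbTE d1) /base.
  case: ifP G2 => [_ _|_ /= ->//]; by rewrite addn1.
- move=> c; rewrite /= negb_or => /andP[nG nd]; rewrite ltn_neqAle nd /=.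
  exact: leq_trans (pdeg_prestr _ _) (degG _ nG).
Qed.

(** In degree above every [m i] nothing has to be settled. Descend from there to
    degree 0, then enlarge the shift at will. *)
Theorem shift_sharp : noetherian k -> exists a0, forall a, (a0 <= a)%N ->
  exists2 rho : pattern m 'I_a -> nat, injective rho & forall c, sharp rho c.
Proof.
move=> k_noeth; pose D := (\max_i m i)%N.
have : sharp_above D.+1.
  exists 'I_0, (lexcode (fun _ => 0%N)), pred0; split=> //; first exact: lexcode_inj.
  move=> c _; rewrite ltnS; apply: leq_trans (leq_bigmax (tag c)).
  by rewrite -[X in (_ <= X)%N]card_ord; apply: max_card.
elim: D.+1 => [|e IH /(sharp_above_step k_noeth)//].
move=> [A [rho [G [rhoI shG _ degG]]]]; exists #|A| => a Aa.
have ioI : injective (fun x : A => widen_ord Aa (enum_rank x)).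
  by move=> x y /(congr1 val)/= /val_inj/enum_rank_inj.
pose io := fi_of ioI; pose base (c : pattern m 'I_a) := rho (prestr io c).
exists (lexcode base); first exact: lexcode_inj.
move=> c; apply: (sharp_shift (io := io) rhoI).
- by apply: shG; apply: contraT => /degG.
- by move=> c1 /lexcode_le.
- by move=> c1 /(@lexcode_lt _ base)/ltnW.
Qed.

End Sharp.

(** * Subquotients isomorphic to M(W) *)

Section Kernel.
Variables (k : comPzRingType) (M M' : lmodType k) (h : {linear M -> M'}).
Fact mker0 : h 0 = 0. Proof. exact: linear0. Qed.
Fact mkerD u v : h u = 0 -> h v = 0 -> h (u + v) = 0.
Proof. by move=> hu hv; rewrite linearD hu hv addr0. Qed.
Fact mkerZ a u : h u = 0 -> h (a *: u) = 0.
Proof. by move=> hu; rewrite linearZ /= hu scaler0. Qed.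
Definition mker : submod M := Submod mker0 mkerD mkerZ.
End Kernel.

Section ImagePreimage.
Variables (k : comPzRingType) (M M' : lmodType k) (h : {linear M -> M'}).

Fact mimage0 : exists x, h x = 0. Proof. by exists 0; apply: linear0. Qed.
Fact mimageD u v : (exists x, h x = u) -> (exists x, h x = v) -> exists x, h x = u + v.
Proof. by move=> [x <-] [y <-]; exists (x + y); rewrite linearD. Qed.
Fact mimageZ a u : (exists x, h x = u) -> exists x, h x = a *: u.
Proof. by move=> [x <-]; exists (a *: x); rewrite linearZ. Qed.
Definition mimage : submod M' := Submod mimage0 mimageD mimageZ.

Variable N : submod M'.
Fact mpreim0 : N (h 0). Proof. by rewrite linear0; apply: submod0. Qed.
Fact mpreimD u v : N (h u) -> N (h v) -> N (h (u + v)).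
Proof. by rewrite linearD; apply: submodD. Qed.
Fact mpreimZ a u : N (h u) -> N (h (a *: u)).
Proof. by rewrite linearZ; apply: submodZ. Qed.
Definition mpreim : submod M := Submod mpreim0 mpreimD mpreimZ.
End ImagePreimage.

Lemma qpi_eq0 (k : comPzRingType) (M : lmodType k) (N : submod M) x : qpi N x = 0 <-> N x.
Proof. by rewrite -(linear0 (qpi N)) qpi_eq subr0. Qed.

Lemma qpi_surj (k : comPzRingType) (M : lmodType k) (N : submod M) (z : Defs.quotm N) :
  exists x, qpi N x = z.
Proof. exact: (ex_intro _ _ (qpiK z)). Qed.

Lemma free_ind (k : comPzRingType) (X : choiceType) (N : submod (freemod k X)) :
  (forall x, N (delta k x)) -> forall u, N u.
Proof.
move=> Nd u; apply/qpi_eq0.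
by apply: (free_ext (f := qpi N) (g := \0%R)) => x; apply/qpi_eq0.
Qed.

Lemma free_lift_sum (k : comPzRingType) (X : finType) (M : lmodType k) (v : X -> M)
    (u : freemod k X) : free_lift v u = \sum_x (u x : k) *: v x.
Proof.
rewrite {1}[u]free_sum linear_sum; apply: eq_bigr => x _.
by rewrite linearZ /= free_lift_delta.
Qed.

Section Morphisms.
Variable k : comPzRingType.
Implicit Types U V W Y Z : fimod k.

Fact fi_mcomp_nat U V W (q : fimor V W) (p : fimor U V) S T (f : fi_hom S T) v :
  (q T \o p T : {linear U T -> W T}) (fi_map U f v) =
  fi_map W f ((q S \o p S : {linear U S -> W S}) v).
Proof. by rewrite /= !fimor_nat. Qed.

Definition fi_mcomp U V W (q : fimor V W) (p : fimor U V) : fimor U W :=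
  FIMor (fi_mcomp_nat q p).

Fact fi_proj_nat V (U : fisub V) S T (f : fi_hom S T) (v : V S) :
  qpi (U T) (fi_map V f v) = fi_map (fi_quot U) f (qpi (U S) v).
Proof. by rewrite [RHS]quotm_mapE. Qed.

Definition fi_proj V (U : fisub V) : fimor V (fi_quot U) :=
  @FIMor k V (fi_quot U) (fun S => qpi (U S)) (@fi_proj_nat V U).

Fact fi_ker_map V W (p : fimor V W) S T (f : fi_hom S T) v :
  mker (p S) v -> mker (p T) (fi_map V f v).
Proof. by rewrite /= fimor_nat => ->; apply: linear0. Qed.

Definition fi_ker V W (p : fimor V W) : fisub V :=
  @FISub k V (fun S => mker (p S)) (@fi_ker_map V W p).

Section Corestriction.
Variables (V W : fimod k) (p : fimor V W) (U : fisub W).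
Hypothesis pU : forall S v, U S (p S v).

Definition corestr_fun S (v : V S) : fi_sub U S :=
  Subm (introT (submod_predP _ _) (pU v)).

Fact corestr_linear S : linear (@corestr_fun S).
Proof. by move=> a u v; apply: val_inj; rewrite /= linearP. Qed.

Definition corestr_at S : {linear V S -> fi_sub U S} :=
  HB.pack_for {linear V S -> fi_sub U S} (@corestr_fun S)
    (GRing.isLinear.Build k (V S) (fi_sub U S) _ (@corestr_fun S) (@corestr_linear S)).

Fact corestr_nat S T (f : fi_hom S T) v :
  corestr_at T (fi_map V f v) = fi_map (fi_sub U) f (corestr_at S v).
Proof. by apply: val_inj; rewrite /= fimor_nat. Qed.

Definition fi_corestr : fimor V (fi_sub U) := @FIMor k V (fi_sub U) corestr_at corestr_nat.
End Corestriction.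

Section Transfer.
Variables (M Y Z : fimod k) (al : fimor M Y) (be : fimor M Z).
Hypotheses (al_surj : fi_surj al) (ker_le : forall S u, al S u = 0 -> be S u = 0).

Definition transfer_fun S (y : Y S) : Z S := be S (projT1 (cid (al_surj y))).

Fact transfer_funE S u : transfer_fun (al S u) = be S u.
Proof.
rewrite /transfer_fun; case: cid => v /= vu; apply/eqP; rewrite -subr_eq0 -linearB.
by apply/eqP/ker_le; rewrite linearB /= vu subrr.
Qed.

Fact transfer_linear S : linear (@transfer_fun S).
Proof.
move=> a y y'; have [[u <-] [u' <-]] := (al_surj y, al_surj y').
by rewrite -linearP !transfer_funE linearP.
Qed.

Definition transfer_at S : {linear Y S -> Z S} :=
  HB.pack_for {linear Y S -> Z S} (@transfer_fun S)
    (GRing.isLinear.Build k (Y S) (Z S) _ (@transfer_fun S) (@transfer_linear S)).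

Fact transfer_nat S T (f : fi_hom S T) y :
  transfer_at T (fi_map Y f y) = fi_map Z f (transfer_at S y).
Proof.
have [u <-] := al_surj y.
by rewrite -fimor_nat [LHS]transfer_funE [in RHS]/= transfer_funE fimor_nat.
Qed.

Definition transfer : fimor Y Z := FIMor transfer_nat.

Lemma transferE S u : transfer S (al S u) = be S u. Proof. exact: transfer_funE. Qed.
End Transfer.

(** Isomorphisms are obtained by comparing two quotients of the same FI-module, which
    avoids defining a map out of a tensor product. *)
Lemma fi_iso_of_surj M Y Z (al : fimor M Y) (be : fimor M Z) :
  fi_surj al -> fi_surj be -> (forall S u, al S u = 0 <-> be S u = 0) -> fi_iso Y Z.
Proof.
move=> sa sb ker.
have ab S u : al S u = 0 -> be S u = 0 by move/ker.
have ba S u : be S u = 0 -> al S u = 0 by move/ker.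
exists (transfer sa ab), (transfer sb ba) => S; split => y.
  by have [u <-] := sa S y; rewrite !transferE.
by have [u <-] := sb S y; rewrite !transferE.
Qed.

End Morphisms.

Section Restriction.
Variables (k : comPzRingType) (m : nat).
Local Notation M := (fi_M k m).

(** The part of [u] supported on the injections with the same image as [h],
    transported to ['I_m] along [h]. *)
Definition restr S (h : fi_hom 'I_m S) (u : M S) : M 'I_m :=
  @mkfree k _ (fun s : fi_hom 'I_m 'I_m => u (fi_comp h s)).

Lemma fi_M_push S T (f : fi_hom S T) (u : M S) h : fi_map M f u (fi_comp f h) = u h.
Proof.
rewrite /= free_map_val (eq_bigl (pred1 h)) ?big_pred1_eq // => h' /=.
exact/inj_eq/fi_comp_inj.
Qed.

Lemma restr_push S T (f : fi_hom S T) (h : fi_hom 'I_m S) (u : M S) :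
  restr (fi_comp f h) (fi_map M f u) = restr h u.
Proof.
apply: dsumP => s.
by have := fi_M_push f u (fi_comp h s); rewrite fi_compA.
Qed.

Lemma fi_endo_imset (s : fi_hom 'I_m 'I_m) : s @: [set: 'I_m] = [set: 'I_m].
Proof.
by apply/eqP; rewrite eqEcard subsetT (card_imset _ (@fi_hom_inj _ _ s)) /=.
Qed.

(** Injections from ['I_m] to [S] are sorted by their image; those with a given image
    differ from one of them by a permutation of ['I_m]. *)
Lemma restr_sum S (u : M S) : u = \sum_(R : {set S})
  (if [pick h : fi_hom 'I_m S | h @: [set: 'I_m] == R] is Some h
   then fi_map M h (restr h u) else 0).
Proof.
apply: dsumP => h1; rewrite dsum_sum (bigD1 (h1 @: [set: 'I_m])) //= big1 ?addr0.
  case: pickP => [h /eqP hR|/(_ h1)]; last by rewrite eqxx.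
  have [j|s ->] := @fi_factor _ _ _ h h1.
    have : h1 j \in h @: [set: 'I_m] by rewrite hR imset_f.
    by case/imsetP => t _ ->; exists t.
  by rewrite fi_M_push.
move=> R nR; case: pickP => // h /eqP hR; rewrite /= free_map_val big1 // => s /eqP hs.
case/eqP: nR; rewrite -hR -hs -{1}(fi_endo_imset s) -imset_comp.
by apply: eq_imset => j; rewrite /= fi_compE.
Qed.

Lemma restr_ind S (N : submod (M S)) (u : M S) :
  (forall h, N (fi_map M h (restr h u))) -> N u.
Proof.
move=> Nh; rewrite [u]restr_sum; elim/big_rec: _ => [|R v _ Nv]; first exact: submod0.
by apply: submodD => //; case: pickP => // *; apply: submod0.
Qed.

End Restriction.

Section Induction.
Variables (k : comPzRingType) (m : nat).
Local Notation M := (fi_M k m).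

Section Rep.
Variable V : fimod k.

Fact fi_rep1 (w : V 'I_m) : fi_map V (fi_perm 1%g) w = w.
Proof.
rewrite -[RHS]fi_map_id; congr (fi_map V _ w).
by apply: fi_hom_eq => i; rewrite !fi_ofE perm1.
Qed.

Fact fi_repM s t (w : V 'I_m) :
  fi_map V (fi_perm (s * t)%g) w = fi_map V (fi_perm t) (fi_map V (fi_perm s) w).
Proof.
rewrite -fi_map_comp; congr (fi_map V _ w).
by apply: fi_hom_eq => i; rewrite fi_compE !fi_ofE permM.
Qed.

Definition fi_rep : perm_rep k m := PermRep fi_rep1 fi_repM.

Local Notation trel S := (tensor_rel (@precomp_perm k m S) (@rep_act k m fi_rep)).

Definition tens S (x : M S) (w : V 'I_m) : fi_ind fi_rep S :=
  qpi (mspan (trel S)) (delta k ((x, w) : (M S * V 'I_m)%type)).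

Lemma tens_eq S x y : trel S (x - y) ->
  qpi (mspan (trel S)) x = qpi (mspan (trel S)) y.
Proof. by move=> r; apply/qpi_eq => N; apply. Qed.

Lemma tens_linear_r S (x : M S) : linear (tens x).
Proof.
move=> a u v; rewrite /tens.
pose d w := delta k ((x, w) : (M S * V 'I_m)%type).
have -> : qpi (mspan (trel S)) (d (a *: u + v)) =
    qpi (mspan (trel S)) (d (a *: u) + d v).
  by apply: tens_eq; rewrite opprD addrA; apply: TensorDr.
by rewrite linearD; congr (_ + _); rewrite -linearZ; apply: tens_eq; apply: TensorZr.
Qed.

Lemma tens_linear_l S (w : V 'I_m) : linear (@tens S ^~ w).
Proof.
move=> a u v; rewrite /tens.
pose d x := delta k ((x, w) : (M S * V 'I_m)%type).
have -> : qpi (mspan (trel S)) (d (a *: u + v)) =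
    qpi (mspan (trel S)) (d (a *: u) + d v).
  by apply: tens_eq; rewrite opprD addrA; apply: TensorDl.
by rewrite linearD; congr (_ + _); rewrite -linearZ; apply: tens_eq; apply: TensorZl.
Qed.

Definition tensr S (x : M S) : {linear V 'I_m -> fi_ind fi_rep S} :=
  HB.pack_for {linear V 'I_m -> fi_ind fi_rep S} (tens x)
    (GRing.isLinear.Build k _ _ _ (tens x) (tens_linear_r x)).

Definition tensl S (w : V 'I_m) : {linear M S -> fi_ind fi_rep S} :=
  HB.pack_for {linear M S -> fi_ind fi_rep S} (@tens S ^~ w)
    (GRing.isLinear.Build k _ _ _ (@tens S ^~ w) (@tens_linear_l S w)).

Lemma tens_map S T (f : fi_hom S T) x w :
  fi_map (fi_ind fi_rep) f (tens x w) = tens (fi_map M f x) w.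
Proof. by rewrite [LHS]quotm_mapE free_map_delta. Qed.

Lemma fi_endo_perm (s : fi_hom 'I_m 'I_m) : s = fi_perm (perm (@fi_hom_inj _ _ s)).
Proof. by apply: fi_hom_eq => i; rewrite fi_ofE permE. Qed.

Lemma tens_perm S (h : fi_hom 'I_m S) (s : fi_hom 'I_m 'I_m) w :
  tens (delta k h) (fi_map V s w) = tens (delta k (fi_comp h s)) w.
Proof.
rewrite [s]fi_endo_perm; symmetry; apply: tens_eq.
set p := perm _; have <- : precomp_perm (delta k h) p = delta k (fi_comp h (fi_perm p)).
  exact: free_map_delta.
exact: TensorG.
Qed.

(** The evaluation from [M(V_m)] to [V], defined before passing to the quotient
    that forms the tensor product. *)
Definition counit S : {linear freemod k (M S * V 'I_m)%type -> V S} :=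
  free_lift (fun p : M S * V 'I_m => free_lift (fun h => fi_map V h p.2) p.1).

Lemma counit_eq0 S x : mspan (trel S) x -> counit S x = 0.
Proof.
move=> /(_ (mker (counit S))); apply => {}x /=.
pose q w : {linear M S -> V S} := free_lift (fun h => fi_map V h w).
have cE y w : counit S (delta k ((y, w) : (M S * V 'I_m)%type)) = q w y.
  by rewrite /counit /= free_lift_delta.
have qE y w : q w y = \sum_h (y h : k) *: fi_map V h w by exact: free_lift_sum.
case=> [a a' b|a b b'|c a b|c a b|a g b].
- by rewrite !(linearB (counit S)) !cE (linearD (q b)) [_ + q b a']addrC addrK subrr.
- rewrite !(linearB (counit S)) !cE; have -> : q (b + b') a = q b a + q b' a.
    by rewrite !qE -big_split; apply: eq_bigr => h _; rewrite /= linearD scalerDr.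
  by rewrite [_ + q b' a]addrC addrK subrr.
- by rewrite (linearB (counit S)) (linearZ_LR (counit S)) !cE (linearZ_LR (q b)) subrr.
- rewrite (linearB (counit S)) (linearZ_LR (counit S)) !cE.
  have -> : q (c *: b) a = c *: q b a.
    rewrite !qE scaler_sumr; apply: eq_bigr => h _.
    by rewrite linearZ_LR !scalerA mulrC.
  by rewrite subrr.
- rewrite (linearB (counit S)) !cE; apply/eqP; rewrite subr_eq0; apply/eqP.
  pose p := free_map k (fun h : fi_hom 'I_m S => fi_comp h (fi_perm g)).
  apply: (free_ext (f := (q b \o p : {linear _ -> _}))
    (g := q (fi_map V (fi_perm g) b))) => h /=.
  by rewrite /p /q free_map_delta !free_lift_delta fi_map_comp.
Qed.

End Rep.

(** For [P] closed under restriction, [M(m)/P] is [M(W)] with [W] its value at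
    ['I_m]. Both are quotients of [M(m)], the second through [h |-> h (x) [id]]. *)
Section QuotientIso.
Variable P : fisub M.
Hypothesis P_restr : forall S u (h : fi_hom 'I_m S), P S u -> P 'I_m (restr h u).
Local Notation Q := (fi_quot P).

Let w0 : Q 'I_m := qpi (P 'I_m) (delta k (fi_id 'I_m)).

Lemma push_delta_id S (h : fi_hom 'I_m S) : fi_map M h (delta k (fi_id 'I_m)) = delta k h.
Proof.
rewrite /= free_map_delta; congr delta; apply: fi_hom_eq => i.
by rewrite fi_compE fi_ofE.
Qed.

Lemma ind_cover_nat S T (f : fi_hom S T) u :
  tensl T w0 (fi_map M f u) = fi_map (fi_ind (fi_rep Q)) f (tensl S w0 u).
Proof. exact/esym/tens_map. Qed.

Definition ind_cover : fimor M (fi_ind (fi_rep Q)) :=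
  @FIMor k M (fi_ind (fi_rep Q)) (fun S => tensl S w0) ind_cover_nat.

Lemma ind_cover_top (v : M 'I_m) :
  ind_cover 'I_m v = tens (V := Q) (delta k (fi_id 'I_m)) (qpi (P 'I_m) v).
Proof.
pose r := tensr Q (delta k (fi_id 'I_m)).
apply: (free_ext (f := ind_cover 'I_m) (g := (r \o qpi (P 'I_m) : {linear _ -> _}))) => s.
have sE : fi_comp (fi_id 'I_m) s = s by apply: fi_hom_eq => i; rewrite fi_compE fi_ofE.
rewrite [RHS]/= -(push_delta_id s) (fi_proj_nat P s) push_delta_id.
by rewrite -[RHS]/(tens _ (fi_map Q s w0)) tens_perm sE.
Qed.

Lemma ind_cover_surj : fi_surj ind_cover.
Proof.
move=> S z; have [t <-] := qpi_surj z; move: t => {z}; set N := mspan _.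
apply: (free_ind (N := mpreim (qpi N) (mimage (ind_cover S)))) => -[x w].
apply: (free_ind (N := mpreim (tensl S w) (mimage (ind_cover S)))) => h.
have [v <-] := qpi_surj w; exists (fi_map M h v).
by rewrite fimor_nat ind_cover_top tens_map push_delta_id.
Qed.

(** The counit maps [u (x) [id]] to the class of [u], which gives one direction; in the
    other, each restriction of [u] is in [P], so its class is zero. *)
Lemma ind_cover_ker S u : ind_cover S u = 0 <-> P S u.
Proof.
split=> [/qpi_eq0/counit_eq0|Pu].
  rewrite /counit /= free_lift_delta /= => u0; apply/qpi_eq0; rewrite -[RHS]u0.
  apply: (free_ext (f := qpi (P S)) (g := free_lift (fun h => fi_map Q h w0))) => h.
  by rewrite [RHS]free_lift_delta -(push_delta_id h) -(fi_proj_nat P h).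
apply: (restr_ind (N := mker (ind_cover S))) => h.
change (ind_cover S (fi_map M h (restr h u)) = 0); rewrite fimor_nat ind_cover_top.
have /qpi_eq0 -> := P_restr h Pu.
have -> : tens (V := Q) (delta k (fi_id 'I_m)) 0 = 0.
  exact: (linear0 (tensr Q (delta k (fi_id 'I_m)))).
exact: linear0.
Qed.

End QuotientIso.

End Induction.

Section Criterion.
Variables (k : comPzRingType) (d : nat) (n : 'I_d -> nat) (X : fimod k).
Variable Pi : fimor (fi_cover k n) X.
Local Notation F := (fi_cover k n).

Section Summand.
Variable r : 'I_d.

Definition single_fun S (u : fi_M k (n r) S) (i : 'I_d) : fi_M k (n i) S :=
  dfwith (fun i => 0 : fi_M k (n i) S) u i.

Definition single S (u : fi_M k (n r) S) : F S := mkdsum (single_fun u).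

Lemma single_in S (u : fi_M k (n r) S) : single u r = u.
Proof. by rewrite /= /single_fun dfwith_in. Qed.

Lemma single_out S (u : fi_M k (n r) S) j : j != r -> single u j = 0.
Proof. by move=> jr; rewrite /= /single_fun dfwith_out // eq_sym. Qed.

Fact single_linear S : linear (@single S).
Proof.
move=> a u v; apply: dsumP => j.
change (single (a *: u + v) j = a *: single u j + single v j).
have [->|jr] := eqVneq j r; first by rewrite !single_in.
by rewrite !single_out // scaler0 addr0.
Qed.

Definition single_at S : {linear fi_M k (n r) S -> F S} :=
  HB.pack_for {linear fi_M k (n r) S -> F S} (@single S)
    (GRing.isLinear.Build k (fi_M k (n r) S) (F S) _ (@single S) (@single_linear S)).

Fact single_nat S T (f : fi_hom S T) u :
  single_at T (fi_map (fi_M k (n r)) f u) = fi_map F f (single_at S u).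
Proof.
apply: dsumP => j.
change (single (fi_map (fi_M k (n r)) f u) j = fi_map (fi_M k (n j)) f (single u j)).
have [->|jr] := eqVneq j r; first by rewrite !single_in.
by rewrite !single_out // linear0.
Qed.

Definition fi_single : fimor (fi_M k (n r)) F := FIMor single_nat.

(** The leading terms at the summand [r] of the kernel of [Pi]. *)
Definition lead_set S (u : fi_M k (n r) S) : Prop :=
  exists L : F S, [/\ Pi S L = 0, forall j : 'I_d, (r < j)%N -> L j = 0 & L r = u].

Fact lead0 S : lead_set (0 : fi_M k (n r) S).
Proof. by exists 0; split=> //; exact: linear0. Qed.
Fact leadD S u v : @lead_set S u -> lead_set v -> lead_set (u + v).
Proof.
move=> [L [L0 Lr <-]] [L' [L'0 L'r <-]]; exists (L + L'); split=> //.
  by rewrite linearD L0 L'0 addr0.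
by move=> j rj; rewrite /= Lr // L'r // addr0.
Qed.
Fact leadZ S a u : @lead_set S u -> lead_set (a *: u).
Proof.
move=> [L [L0 Lr <-]]; exists (a *: L); split=> //.
  by rewrite linearZ /= L0 scaler0.
by move=> j rj; rewrite /= Lr // scaler0.
Qed.
Fact lead_map S T (f : fi_hom S T) u :
  @lead_set S u -> lead_set (fi_map (fi_M k (n r)) f u).
Proof.
move=> [L [L0 Lr <-]]; exists (fi_map F f L); split=> //.
  by rewrite fimor_nat L0 linear0.
by move=> j rj; rewrite /= Lr // linear0.
Qed.

Definition lead : fisub (fi_M k (n r)) :=
  @FISub k (fi_M k (n r))
    (fun S => Submod (@lead0 S) (@leadD S) (@leadZ S)) lead_map.

Lemma single_stage S u : stage Pi r.+1 S (Pi S (single u)).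
Proof.
exists (single u) => // j rj; apply: single_out.
by apply: contraTneq rj => ->; rewrite ltnn.
Qed.

(** The step [V^(r+1) / V^r] is a quotient of the summand [r] of the cover. *)
Definition step_cover : fimor (fi_M k (n r)) (fi_subquot (stage Pi r.+1) (stage Pi r)) :=
  fi_mcomp (fi_proj _)
    (fi_corestr (p := fi_mcomp Pi fi_single) (U := stage Pi r.+1) single_stage).

Lemma step_cover_surj : fi_surj step_cover.
Proof.
move=> S y; have [[w wU] <-] := qpi_surj y.
have /submod_predP[L Lr Lw] := wU; exists (L r); apply/qpi_eq.
exists (single (L r) - L); last by rewrite linearB /= Lw.
move=> j rj; rewrite dsum_subE; have [->|jr] := eqVneq j r.
  by rewrite single_in subrr.
rewrite single_out // sub0r Lr ?oppr0 //.
by rewrite ltn_neqAle rj andbT eq_sym.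
Qed.

Lemma step_cover_ker S u : step_cover S u = 0 <-> lead S u.
Proof.
split=> [/qpi_eq0[L Lr LE]|[L [L0 Lr <-]]].
  exists (single u - L); split.
  - by rewrite linearB LE subrr.
  - move=> j rj; rewrite dsum_subE single_out; last first.
      by apply: contraTneq rj => ->; rewrite ltnn.
    by rewrite Lr ?subr0 // ltnW.
  - by rewrite dsum_subE single_in Lr // subr0.
apply/qpi_eq0; exists (single (L r) - L); last by rewrite linearB L0 subr0.
move=> j rj; rewrite dsum_subE; have [->|jr] := eqVneq j r.
  by rewrite single_in subrr.
rewrite single_out // sub0r Lr ?oppr0 //.
by rewrite ltn_neqAle rj andbT eq_sym.
Qed.

End Summand.

Hypothesis Pi_surj : fi_surj Pi.
Hypothesis lead_restr : forall r S u (h : fi_hom 'I_(n r) S),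
  lead r S u -> lead r 'I_(n r) (restr h u).

(** Each step is [M(n r)] modulo the leading terms, and leading terms closed under
    restriction are generated in degree [n r]. *)
Theorem sharp_filtration_of_lead : sharp_filtration Pi.
Proof.
split=> // r; exists (fi_rep (n r) (fi_quot (lead r))).
apply: (fi_iso_of_surj (@step_cover_surj r) (@ind_cover_surj _ _ (lead r))) => S u.
rewrite step_cover_ker ind_cover_ker //.
exact: lead_restr.
Qed.

(** If the image of an element under [f] vanishes, then the image under [f] of its
    leading term is a leading term of the kernel. Restricting to the image of [f]
    shows that the leading term itself comes from the kernel, and may be
    cancelled. *)
Lemma fi_map_inj_of_lead S T (f : fi_hom S T) x : fi_map X f x = 0 -> x = 0.
Proof.
have [L <-] := Pi_surj x; rewrite -fimor_nat.
suff {L} stages r (L : F S) : (forall j : 'I_d, (r <= j)%N -> L j = 0) ->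
    Pi T (fi_map F f L) = 0 -> Pi S L = 0.
  by apply: (stages d) => j; rewrite leqNgt ltn_ord.
elim: r L => [|r IH] L Lr L0.
  by have -> : L = 0; [apply: dsumP => j; apply: Lr|exact: linear0].
have [rd|dr] := ltnP r d; last first.
  by apply: IH => // j rj; have := leq_trans dr rj; rewrite leqNgt ltn_ord.
pose i := Ordinal rd.
have Li : lead i S (L i).
  apply: restr_ind => h; apply: fisub_map; rewrite -(restr_push f).
  by apply: lead_restr; exists (fi_map F f L); split=> // j ij; rewrite /= Lr ?linear0.
have [L' [L'0 L'r L'E]] := Li.
rewrite -(subrK L' L) linearD L'0 addr0; apply: IH.
  move=> j rj; rewrite dsum_subE; have [->|ji] := eqVneq j i; first by rewrite L'E subrr.
  have ij : (r < j)%N by rewrite ltn_neqAle rj andbT eq_sym.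
  by rewrite Lr // L'r // subr0.
by rewrite linearB linearB L0 fimor_nat L'0 linear0 subr0.
Qed.

End Criterion.

(** * The shift of a cover as a cover *)

Section CoordinateMaps.
Variable k : comPzRingType.

(** The transport along an equality of degrees, extended by zero so that no proof of
    the equality is needed to state it. *)
Definition recast p q S (u : fi_M k p S) : fi_M k q S :=
  if p =P q is ReflectT E then ecast x (fi_M k x S) E u else 0.

Lemma recast_ecast p q (E : p = q) S (u : fi_M k p S) :
  recast q u = ecast x (fi_M k x S) E u.
Proof. by rewrite /recast; case: eqP => // E'; rewrite (eq_irrelevance E' E). Qed.

Definition fi_cast p q (E : p = q) : fi_hom 'I_p 'I_q := fi_of (@cast_ord_inj p q E).

Lemma recastE p q (E : p = q) S (u : fi_M k p S) (h : fi_hom 'I_q S) :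
  recast q u h = u (fi_comp h (fi_cast E)).
Proof.
rewrite (recast_ecast E); case: q / E h => h /=; congr (u _).
by apply: fi_hom_eq => j; rewrite fi_compE fi_ofE cast_ord_id.
Qed.

Lemma recast_linear p q S : linear (@recast p q S).
Proof.
move=> a u v; rewrite /recast; case: eqP => [E|_]; last by rewrite scaler0 addr0.
by case: q / E.
Qed.

Lemma recast_nat p q S T (f : fi_hom S T) (u : fi_M k p S) :
  recast q (fi_map (fi_M k p) f u) = fi_map (fi_M k q) f (recast q u).
Proof.
rewrite /recast; case: eqP => [E|_]; last by rewrite linear0.
by case: q / E.
Qed.

Section Map.
Variables (d d' : nat) (m : 'I_d -> nat) (m' : 'I_d' -> nat) (tau : 'I_d' -> option 'I_d).
Local Notation F := (fi_cover k m).
Local Notation F' := (fi_cover k m').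

(** [tau] goes from the target to the source, so that each coordinate of the image is
    a single coordinate of the argument. *)
Definition cmap_coord S (L : F S) (j : 'I_d') : fi_M k (m' j) S :=
  if tau j is Some i then recast (m' j) (L i) else 0.

Definition cmap_fun S (L : F S) : F' S := mkdsum (cmap_coord L).

Fact cmap_linear S : linear (@cmap_fun S).
Proof.
move=> a u v; apply: dsumP => j.
change (cmap_coord (a *: u + v) j = a *: cmap_coord u j + cmap_coord v j).
rewrite /cmap_coord; case: (tau j) => [i|]; last by rewrite scaler0 addr0.
exact: recast_linear.
Qed.

Definition cmap_at S : {linear F S -> F' S} :=
  HB.pack_for {linear F S -> F' S} (@cmap_fun S)
    (GRing.isLinear.Build k (F S) (F' S) _ (@cmap_fun S) (@cmap_linear S)).

Fact cmap_nat S T (f : fi_hom S T) L :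
  cmap_at T (fi_map F f L) = fi_map F' f (cmap_at S L).
Proof.
apply: dsumP => j.
change (cmap_coord (fi_map F f L) j = fi_map (fi_M k (m' j)) f (cmap_coord L j)).
rewrite /cmap_coord; case: (tau j) => [i|]; last by rewrite linear0.
exact: recast_nat.
Qed.

Definition cmap : fimor F F' := FIMor cmap_nat.

Lemma cmapE S (L : F S) j :
  cmap S L j = if tau j is Some i then recast (m' j) (L i) else 0.
Proof. by []. Qed.

End Map.
End CoordinateMaps.

(** The map of covers given by [tau] is the inclusion of the source as a sum of
    some of the summands of the target. *)
Definition embeds (d d' : nat) (m : 'I_d -> nat) (m' : 'I_d' -> nat)
    (tau : 'I_d' -> option 'I_d) : Prop :=
  [/\ forall r i, tau r = Some i -> m' r = m i,
      forall r r' i, tau r = Some i -> tau r' = Some i -> r = r'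
    & forall i, exists r, tau r = Some i].

Section ShiftMaps.
Variables (k : comPzRingType) (a : nat).

Fact fi_shift_mor_nat (V W : fimod k) (p : fimor V W) S T (f : fi_hom S T) v :
  p (T + 'I_a)%type (fi_map (fi_shift a V) f v) =
  fi_map (fi_shift a W) f (p (S + 'I_a)%type v).
Proof. exact: fimor_nat. Qed.

Definition fi_shift_mor (V W : fimod k) (p : fimor V W) :
    fimor (fi_shift a V) (fi_shift a W) :=
  @FIMor k (fi_shift a V) (fi_shift a W) (fun S => p (S + 'I_a)%type)
    (fi_shift_mor_nat p).

Lemma fi_add_inl S T (f : fi_hom S T) :
  fi_comp (fi_add a f) (hom_inl S 'I_a) = fi_comp (hom_inl T 'I_a) f.
Proof. by apply: fi_hom_eq => s; rewrite !fi_compE !fi_ofE. Qed.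

Lemma fi_add_inr S T (f : fi_hom S T) :
  fi_comp (fi_add a f) (hom_inr S 'I_a) = hom_inr T 'I_a.
Proof. by apply: fi_hom_eq => s; rewrite !fi_compE !fi_ofE. Qed.

Lemma fi_add_comp S T U (g : fi_hom T U) (f : fi_hom S T) :
  fi_comp (fi_add a g) (fi_add a f) = fi_add a (fi_comp g f).
Proof.
by apply: fi_hom_eq => -[s|i]; rewrite !fi_compE ?fi_ofE //= ?fi_ofE ?fi_compE.
Qed.

Fact fi_unit_nat (V : fimod k) S T (f : fi_hom S T) (v : V S) :
  fi_map V (hom_inl T 'I_a) (fi_map V f v) =
  fi_map (fi_shift a V) f (fi_map V (hom_inl S 'I_a) v).
Proof. by rewrite /= -!fi_map_comp fi_add_inl. Qed.

Definition fi_unit (V : fimod k) : fimor V (fi_shift a V) :=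
  @FIMor k V (fi_shift a V) (fun S => fi_map V (hom_inl S 'I_a)) (@fi_unit_nat V).

End ShiftMaps.

Lemma pat_eq (d : nat) (m : 'I_d -> nat) (A X Y : finType) (al : fi_hom A X) (be : fi_hom A Y)
    (b : basis m X) (g : basis m Y) : pat al b = pat be g ->
  exists2 h : fi_hom 'I_(m (tag g)) X, b = bas h &
    forall j a, (al a == h j) = (be a == tagged g j).
Proof.
case: b g => [i h] [i' h0] E; have ii' : i = i' := congr1 tag E.
subst i'; exists h => // j a.
rewrite -[LHS](@pat_Some _ _ _ _ al (bas h)) -[RHS](@pat_Some _ _ _ _ be (bas h0)).
by move/eqP: E; rewrite eq_Tagged => /eqP /= ->.
Qed.

Section Reindex.
Variables (k : comPzRingType) (d : nat) (m : 'I_d -> nat) (a : nat).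
Variable rho : pattern m 'I_a -> nat.
Hypothesis rhoI : injective rho.
Local Notation F := (fi_cover k m).
Local Notation inA T := (hom_inr T 'I_a).

(** Patterns that take a value in ['I_a] twice are not traces of injections. *)
Definition realized (c : pattern m 'I_a) : bool :=
  [exists b : basis m ('I_(pdeg c) + 'I_a)%type, pat (inA _) b == c].

Definition patterns : seq (pattern m 'I_a) :=
  sort (fun c c' => (rho c <= rho c')%N) [seq c <- enum {: pattern m 'I_a} | realized c].

Definition nth_pattern (r : 'I_(size patterns)) : pattern m 'I_a := tnth (in_tuple patterns) r.
Definition shift_deg (r : 'I_(size patterns)) : nat := pdeg (nth_pattern r).

Lemma mem_patterns c : (c \in patterns) = realized c.
Proof. by rewrite mem_sort mem_filter mem_enum andbT. Qed.

Lemma nth_pattern_inj : injective nth_pattern.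
Proof.
move=> r r' /eqP; rewrite /nth_pattern !(tnth_nth (nth_pattern r)) nth_uniq ?ltn_ord //.
  by move/eqP/val_inj.
by rewrite sort_uniq filter_uniq // enum_uniq.
Qed.

Lemma nth_pattern_realized r : realized (nth_pattern r).
Proof. by rewrite -mem_patterns mem_tnth. Qed.

Lemma nth_pattern_onto c : realized c -> exists r, nth_pattern r = c.
Proof.
rewrite -mem_patterns => cc; have /tnthP[r ->] : c \in in_tuple patterns by [].
by exists r.
Qed.

Lemma nth_pattern_le (r r' : 'I_(size patterns)) :
  (r <= r')%N -> (rho (nth_pattern r) <= rho (nth_pattern r'))%N.
Proof.
rewrite /nth_pattern !(tnth_nth (nth_pattern r)) => rr'.
have := @sorted_leq_nth _ (fun c c' : pattern m 'I_a => (rho c <= rho c')%N).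
apply=> //; try exact: ltn_ord.
- by move=> c c' c''; apply: leq_trans.
- by apply: sort_sorted => c c'; apply: leq_total.
Qed.

Lemma nth_pattern_lt (r r' : 'I_(size patterns)) :
  (r < r')%N -> (rho (nth_pattern r) < rho (nth_pattern r'))%N.
Proof.
move=> lt; rewrite ltn_neqAle nth_pattern_le ?andbT 1?ltnW //.
by apply: contraTneq lt => /rhoI/nth_pattern_inj ->; rewrite ltnn.
Qed.

(** The points that are not sent to ['I_a] keep their number. *)
Definition straight n (b : basis m ('I_n + 'I_a)%type) : bool :=
  [forall j, if tagged b j is inl t then (t : nat) == j else true].

Definition straightenable r : Prop :=
  exists b : basis m ('I_(shift_deg r) + 'I_a)%type,
    pat (inA _) b = nth_pattern r /\ straight b.

Lemma model_spec r : exists b : basis m ('I_(shift_deg r) + 'I_a)%type,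
  pat (inA _) b = nth_pattern r /\ (straightenable r -> straight b).
Proof.
have [[b [bc sb]]|ns] := pselect (straightenable r); first by exists b.
by have /existsP[b /eqP bc] := nth_pattern_realized r; exists b; split.
Qed.

(** A basis element with the given pattern that is onto the free part. Every
    other basis element with this pattern is its image under a unique injection
    of the free part, so that the summand of the shifted cover belonging to the
    pattern is free on this element. The choice matters for the patterns that
    avoid ['I_a]: only a straight model makes the inclusion of the cover into its
    shift the identity on the summands, as sequentiality requires, and not the
    identity up to a permutation. *)
Definition model r : basis m ('I_(shift_deg r) + 'I_a)%type := projT1 (cid (model_spec r)).

Lemma pat_model r : pat (inA _) (model r) = nth_pattern r.
Proof. by rewrite /model; case: cid => b /= []. Qed.

Lemma model_straight r : straightenable r -> straight (model r).
Proof. by rewrite /model; case: cid => b /= []. Qed.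

Lemma model_full r (t : 'I_(shift_deg r)) : exists j, tagged (model r) j = inl t.
Proof.
have /imsetP[j _ E] : inl t \in bimg (model r).
  apply: (@bimg_full _ _ _ _ (inA _)); first by rewrite pat_model card_sum !card_ord.
  by apply/imsetP => -[x _]; rewrite fi_ofE.
by exists j.
Qed.

(** The bijection of bases behind the decomposition of the shifted cover. *)
Definition gmap T (b : basis shift_deg T) : basis m (T + 'I_a)%type :=
  bmap (fi_add a (tagged b)) (model (tag b)).

Lemma gmap_bmap S T (f : fi_hom S T) (b : basis shift_deg S) :
  gmap (bmap f b) = bmap (fi_add a f) (gmap b).
Proof. by rewrite /gmap /= bmap_comp fi_add_comp. Qed.

Lemma pat_gmap T (b : basis shift_deg T) : pat (inA _) (gmap b) = nth_pattern (tag b).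
Proof. by rewrite -(fi_add_inr _ (tagged b)) pat_bmap pat_model. Qed.

Lemma gmap_inj T : injective (@gmap T).
Proof.
move=> [r h] [r' h'] E.
have := congr1 (pat (inA _)) E; rewrite !pat_gmap /= => /nth_pattern_inj rr'.
subst r'; congr (Tagged _ _); apply: fi_hom_eq => t; have [j jt] := model_full t.
move/eqP: E; rewrite /gmap /= eq_Tagged => /eqP /= /(congr1 (fun f : fi_hom _ _ => f j)).
by rewrite !fi_compE jt !fi_ofE => -[].
Qed.

(** A basis element factors through the union of ['I_a] and its free part. *)
Lemma realized_pat (T : finType) (b : basis m (T + 'I_a)%type) : realized (pat (inA _) b).
Proof.
set c := pat _ b; pose S := [set t | inl t \in bimg b].
have cS : #|S| = pdeg c.
  rewrite pdeg_pat -(card_imset _ (@inl_inj T 'I_a)); congr #|pred_of_set _|.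
  apply/setP => z; apply/imsetP/setDP => [[t tS ->]|[zb nz]].
    by rewrite inE in tS; split=> //; apply/imsetP => -[x _]; rewrite fi_ofE.
  case: z zb nz => [t|x] zb nz; first by exists t; rewrite ?inE.
  by case/negP: nz; apply/imsetP; exists x; rewrite ?fi_ofE.
have eI : injective (fun r : 'I_(pdeg c) => enum_val (cast_ord (esym cS) r)).
  by move=> r r' /enum_val_inj /cast_ord_inj.
have [z zb|b1 bE] := @bmap_factor _ _ _ _ (fi_add a (fi_of eI)) b.
  case: z zb => [t|x] zb; last by exists (inr x); rewrite fi_ofE.
  have tS : t \in S by rewrite inE.
  exists (inl (cast_ord cS (enum_rank_in tS t))).
  by rewrite !fi_ofE cast_ordK enum_rankK_in.
by apply/existsP; exists b1; rewrite -(pat_bmap (fi_add a (fi_of eI))) fi_add_inr -bE.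
Qed.

(** Two basis elements with the same pattern differ by the bijection of their free
    parts that matches the images of the same point. *)
Lemma gmap_onto (T : finType) (b : basis m (T + 'I_a)%type) : exists b', gmap b' = b.
Proof.
have [r rc] := nth_pattern_onto (realized_pat b).
have [h -> hE] := pat_eq (etrans (esym rc) (esym (pat_model r))).
have ex t : exists x, exists2 j, tagged (model r) j = inl t & h j = inl x.
  have [j jt] := model_full t; case hj: (h j) => [x|x]; first by exists x, j.
  by have := hE j x; rewrite hj jt !fi_ofE !eqxx.
have [f fE] := choice ex.
have fI : injective f.
  move=> t t' ff; have [[j jt hj] [j' jt' hj']] := (fE t, fE t').
  move: hj; rewrite ff -hj' => /fi_hom_inj jj'.
  by move: jt; rewrite jj' jt' => -[].
exists (bas (m := shift_deg) (fi_of fI)); congr (Tagged _ _); apply: fi_hom_eq => j.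
rewrite fi_compE fi_ofE; case jt: (tagged (model r) j) => [t|x].
  have [j' jt' hj'] := fE t; rewrite fi_ofE -hj'; congr (h _).
  by apply: (@fi_hom_inj _ _ (tagged (model r))); rewrite jt'.
by have := hE j x; rewrite jt !fi_ofE !eqxx => /eqP <-.
Qed.

Definition ginv (T : finType) (b : basis m (T + 'I_a)%type) : basis shift_deg T :=
  projT1 (cid (gmap_onto b)).

Lemma ginvK T : cancel (@ginv T) (@gmap T).
Proof. by move=> b; rewrite /ginv; case: cid. Qed.

Lemma gmapK T : cancel (@gmap T) (@ginv T).
Proof. by move=> b; apply: gmap_inj; rewrite ginvK. Qed.

Definition unshift_fun T (L : fi_cover k shift_deg T) : fi_shift a F T :=
  mkcov (fun b => bcoef L (ginv b)).

Fact unshift_linear T : linear (@unshift_fun T).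
Proof.
move=> x u v; apply: bcoefP => b.
by rewrite bcoefD bcoefZ !bcoef_mkcov bcoefD bcoefZ.
Qed.

Definition unshift_at T : {linear fi_cover k shift_deg T -> fi_shift a F T} :=
  HB.pack_for {linear fi_cover k shift_deg T -> fi_shift a F T} (@unshift_fun T)
    (GRing.isLinear.Build k (fi_cover k shift_deg T) (fi_shift a F T) _ (@unshift_fun T)
      (@unshift_linear T)).

Lemma bcoef_unshift T L (b : basis shift_deg T) : bcoef (unshift_fun L) (gmap b) = bcoef L b.
Proof. by rewrite bcoef_mkcov gmapK. Qed.

Fact unshift_nat S T (f : fi_hom S T) L :
  unshift_at T (fi_map (fi_cover k shift_deg) f L) = fi_map (fi_shift a F) f (unshift_at S L).
Proof.
apply: bcoefP => b; rewrite -(ginvK b); move: (ginv b) => {}b.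
rewrite [LHS]bcoef_unshift; have [[b0 ->]|nb] := pselect (exists b0, b = bmap f b0).
  by rewrite bcoef_push gmap_bmap [RHS]bcoef_push bcoef_unshift.
rewrite [LHS](_ : _ = 0); last first.
  apply/eqP; apply: contra_notT nb => /bcoef_push_neq0[b0 -> _]; by exists b0.
symmetry; apply/eqP; apply: contra_notT nb => /bcoef_push_neq0[b1 + _].
by rewrite -(ginvK b1) -gmap_bmap => /gmap_inj ->; exists (ginv b1).
Qed.

Definition unshift : fimor (fi_cover k shift_deg) (fi_shift a F) :=
  @FIMor k (fi_cover k shift_deg) (fi_shift a F) unshift_at unshift_nat.

Lemma unshift_mkcov T (x : fi_shift a F T) :
  unshift T (mkcov (fun b => bcoef (x : F (T + 'I_a)%type) (gmap b))) = x.
Proof.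
apply: bcoefP => b.
by rewrite -(ginvK b) [LHS]bcoef_unshift bcoef_mkcov.
Qed.

Section Criterion.
Variables (V : fimod k) (Pi : fimor F V).
Hypothesis Pi_surj : fi_surj Pi.

Definition shift_cover : fimor (fi_cover k shift_deg) (fi_shift a V) :=
  fi_mcomp (fi_shift_mor a Pi) unshift.

Lemma shift_cover_surj : fi_surj shift_cover.
Proof.
move=> S w; have [x <-] := Pi_surj (w : V (S + 'I_a)%type).
exists (mkcov (fun b => bcoef x (gmap b))).
exact: (congr1 (Pi _) (unshift_mkcov (x : fi_shift a F S))).
Qed.

Hypothesis rho_sharp : forall c, sharp (fi_ker Pi) rho c.

Lemma shift_cover_lead r S u (h : fi_hom 'I_(shift_deg r) S) :
  lead shift_cover r S u -> lead shift_cover r 'I_(shift_deg r) (restr h u).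
Proof.
move=> [L [L0 Lr <-]].
pose x : F (S + 'I_a)%type := unshift S L.
have addE := fi_add_inr a h.
have [|//||y [Ky ys yc]] := rho_sharp (c := nth_pattern r) (al := inA 'I_(shift_deg r))
    (e := fi_add a h) _ (x := x).
- by rewrite card_sum !card_ord.
- move=> b; rewrite addE -(ginvK b); move: (ginv b) => {}b.
  rewrite bcoef_unshift pat_gmap => nz; apply: nth_pattern_le; rewrite leqNgt.
  by apply: contra_neqN nz => rb; rewrite /bcoef Lr.
exists (mkcov (fun b => bcoef y (gmap b))); split.
- exact: etrans (congr1 (Pi _) (unshift_mkcov (y : fi_shift a F 'I_(shift_deg r)))) Ky.
- move=> j rj; apply: dsumP => s; rewrite [RHS]/=.
  apply: contrapT => /eqP nz; have := ys (gmap (bas s)) nz.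
  by rewrite pat_gmap leqNgt nth_pattern_lt.
- apply: dsumP => s.
  have := yc (gmap (bas s)); rewrite pat_gmap => /(_ erefl) E.
  by rewrite [LHS]E -gmap_bmap [LHS]bcoef_unshift.
Qed.

Theorem shift_cover_filtration : sharp_filtration shift_cover.
Proof. exact: sharp_filtration_of_lead shift_cover_surj shift_cover_lead. Qed.

Theorem shift_map_inj S T (f : fi_hom S T) x : fi_map (fi_shift a V) f x = 0 -> x = 0.
Proof. exact: fi_map_inj_of_lead shift_cover_surj shift_cover_lead _ _ f x. Qed.

End Criterion.

Definition free_pattern (i : 'I_d) : pattern m 'I_a := mkpattern [ffun _ : 'I_(m i) => None].

(** The summand of the original cover that is included as the summand [r] of the
    shift, if any. *)
Definition origin (r : 'I_(size patterns)) : option 'I_d :=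
  let i := tag (nth_pattern r) in if nth_pattern r == free_pattern i then Some i else None.

Lemma originP r i : origin r = Some i <-> nth_pattern r = free_pattern i.
Proof.
rewrite /origin; split=> [|->]; last by rewrite eqxx.
by case: eqP => // + [<-].
Qed.

Lemma pdeg_free_pattern i : pdeg (free_pattern i) = m i.
Proof.
rewrite -[RHS]card_ord -cardsT; congr #|pred_of_set _|.
by apply/setP => j; rewrite !inE /= ffunE.
Qed.

Lemma origin_deg r i : origin r = Some i -> shift_deg r = m i.
Proof. by move=> /originP E; rewrite /shift_deg E pdeg_free_pattern. Qed.

Lemma origin_inj r r' i : origin r = Some i -> origin r' = Some i -> r = r'.
Proof. by move=> /originP E /originP E'; apply: nth_pattern_inj; rewrite E E'. Qed.

Lemma pat_inl T (b : basis m T) : pat (inA T) (bmap (hom_inl T 'I_a) b) = free_pattern (tag b).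
Proof.
congr mkpattern; apply/ffunP => j; rewrite [LHS]ffunE [RHS]ffunE; case: pickP => // x.
by rewrite fi_compE !fi_ofE.
Qed.

Lemma origin_onto i : exists r, origin r = Some i.
Proof.
have := realized_pat (bmap (hom_inl 'I_(m i) 'I_a) (bas (fi_id 'I_(m i)))).
by rewrite pat_inl /= => /nth_pattern_onto[r /originP]; exists r.
Qed.

(** A point sent to ['I_a] is no longer free. *)
Lemma origin_None r : origin r = None -> exists i, (shift_deg r < m i)%N.
Proof.
rewrite /origin; case: eqP => // ne _; exists (tag (nth_pattern r)).
rewrite /shift_deg /pdeg -[X in (_ < X)%N]card_ord -cardsT; apply: proper_card.
rewrite properE subsetT; apply/subsetPn; apply: contrapT => nex; apply: ne.
case: (nth_pattern r) nex => i g nex; congr mkpattern; apply/ffunP => j; rewrite ffunE.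
apply: contrapT => gj; apply: nex; exists j; rewrite ?inE //=.
exact/eqP.
Qed.

Lemma model_origin r i : nth_pattern r = free_pattern i ->
  exists E : m i = shift_deg r, model r = bas (fi_comp (hom_inl _ 'I_a) (fi_cast E)).
Proof.
move=> ci; have E : m i = shift_deg r by rewrite /shift_deg ci pdeg_free_pattern.
exists E.
pose b0 := bas (m := m) (fi_comp (hom_inl _ 'I_a) (fi_cast E)).
have tr0 : pat (inA _) b0 = free_pattern i by apply: (pat_inl (bas (fi_cast E))).
have sg : straight (model r).
  apply: model_straight; exists b0; split; first by rewrite tr0.
  apply/forallP => j; have -> : tagged b0 j = inl (cast_ord E j) by rewrite fi_compE !fi_ofE.
  exact: eqxx.
have := pat_eq (etrans (pat_model r) (etrans ci (esym tr0))).
move=> [h gE hj]; rewrite gE; congr bas; apply: fi_hom_eq => j.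
move: sg; rewrite gE => /forallP /(_ j) sj.
have {}sj : if h j is inl t then (t : nat) == j else true := sj.
rewrite fi_compE !fi_ofE; case hE: (h j) sj => [t|x] sj.
  by congr inl; apply/val_inj/eqP.
have := hj j x; rewrite hE fi_ofE eqxx => /esym/eqP.
by rewrite fi_compE !fi_ofE.
Qed.

Lemma unshift_cmap S (L : F S) :
  unshift S (cmap k m shift_deg origin S L) = fi_map F (hom_inl S 'I_a) L.
Proof.
apply: bcoefP => b; rewrite -(ginvK b); move: (ginv b) => {b}[r h].
rewrite [LHS]bcoef_unshift.
change ((if origin r is Some i then recast (shift_deg r) (L i)
         else 0 : fi_M k (shift_deg r) S) h =
  bcoef (fi_map F (hom_inl S 'I_a) L) (gmap (bas (m := shift_deg) h))).
case oE: (origin r) => [i|].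
  have /originP ci := oE; have [E gE] := model_origin ci.
  rewrite (recastE E).
  have -> : gmap (bas (m := shift_deg) h) = bmap (hom_inl S 'I_a) (bas (fi_comp h (fi_cast E))).
    by rewrite /gmap /= gE /bmap /= !fi_compA fi_add_inl.
  by rewrite bcoef_push.
symmetry; apply/eqP; apply: contraT => /bcoef_push_neq0[b1 bE _].
have := pat_gmap (bas (m := shift_deg) h); rewrite bE pat_inl /= => /esym/originP.
by rewrite oE.
Qed.

End Reindex.

(** The shift theorem with its cover: [tau] locates the summands of the original
    cover among those of the cover of the shift, and the other summands have smaller
    degree. *)
Theorem shift_presentation (k : comPzRingType) (V : fimod k) (d : nat) (m : 'I_d -> nat)
    (Pi : fimor (fi_cover k m) V) : noetherian k -> fi_surj Pi ->
  exists a0, forall a, (a0 <= a)%N ->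
  exists (e : nat) (n : 'I_e -> nat) (PiJ : fimor (fi_cover k n) (fi_shift a V))
    (tau : 'I_e -> option 'I_d),
  [/\ sharp_filtration PiJ,
      forall S T (f : fi_hom S T) x, fi_map (fi_shift a V) f x = 0 -> x = 0,
      forall S L, PiJ S (cmap k m n tau S L) = fi_unit a V S (Pi S L),
      embeds m n tau
    & forall r, tau r = None -> exists i, (n r < m i)%N].
Proof.
move=> k_noeth Pi_surj; have [a0 a0P] := shift_sharp (fi_ker Pi) k_noeth.
exists a0 => a /a0P[rho rhoI rho_sharp].
exists _, (shift_deg (rho := rho)), (shift_cover rho Pi), (origin (rho := rho)); split.
- exact: shift_cover_filtration.
- exact: shift_map_inj rho_sharp.
- by move=> S L; apply: etrans (congr1 (Pi _) (unshift_cmap rho L)) (fimor_nat _ _ _).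
- split; [exact: origin_deg|exact: origin_inj|exact: origin_onto].
- exact: origin_None.
Qed.

(** * The resolution *)

(** Once [X] is the union of some [T] and ['I_a], the inclusion of [X] into the union
    of [X] and ['I_a] differs from the map obtained by shifting the inclusion of [T]
    only by the exchange of the two copies of ['I_a]. *)
Lemma fi_unit_inj (k : comPzRingType) (V : fimod k) (a : nat) :
  (forall S T (f : fi_hom S T) x, fi_map (fi_shift a V) f x = 0 -> x = 0) ->
  forall X : finType, (a <= #|X|)%N -> injective (fi_unit a V X).
Proof.
move=> inj X aX; suff ker0 x : fi_unit a V X x = 0 -> x = 0.
  move=> x y /eqP; rewrite -subr_eq0 -linearB => /eqP/ker0/eqP.
  by rewrite subr_eq0 => /eqP.
pose T : finType := 'I_(#|X| - a).
have cT : #|X| = #|{: T + 'I_a}| by rewrite card_sum !card_ord subnK.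
have beI : injective (fun t : T + 'I_a => enum_val (cast_ord (esym cT) (enum_rank t))).
  by move=> t t' /enum_val_inj/cast_ord_inj/enum_rank_inj.
have gaI : injective (fun z : X => enum_val (cast_ord cT (enum_rank z))).
  by move=> t t' /enum_val_inj/cast_ord_inj/enum_rank_inj.
pose be := fi_of beI; pose ga := fi_of gaI.
have bega : fi_comp be ga = fi_id X.
  by apply: fi_hom_eq => z; rewrite fi_compE !fi_ofE enum_valK cast_ordK enum_rankK.
have gabe : fi_comp ga be = fi_id _.
  by apply: fi_hom_eq => z; rewrite fi_compE !fi_ofE enum_valK cast_ordKV enum_rankK.
pose swap (z : (T + 'I_a) + 'I_a) : ((T + 'I_a) + 'I_a)%type :=
  match z with inl (inl t) => inl (inl t) | inl (inr i) => inr i | inr i => inl (inr i) end.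
have swapI : injective swap by move=> [[t|i]|i] [[t'|i']|i'] //= [->].
have swapE : fi_comp (fi_of swapI) (hom_inl (T + 'I_a)%type 'I_a) = fi_add a (hom_inl T 'I_a).
  by apply: fi_hom_eq => -[t|i]; rewrite fi_compE !fi_ofE //= fi_ofE.
rewrite -(fi_map_id x) -bega fi_map_comp; set y := fi_map V ga x.
move=> /(congr1 (fi_map V (fi_add a ga))); rewrite linear0 => E.
have uy : fi_unit a V _ y = 0.
  by rewrite -[X in fi_unit a V _ X]fi_map_id -gabe fi_map_comp (fimor_nat (fi_unit a V)).
have -> : y = 0; last exact: linear0.
apply: (inj T _ (hom_inl T 'I_a)) => /=; rewrite -swapE fi_map_comp.
by rewrite -[X in fi_map V _ X]/(fi_unit a V _ y) uy linear0.
Qed.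

Section Embedding.
Variables (k : comPzRingType) (d d' : nat) (m : 'I_d -> nat) (m' : 'I_d' -> nat).
Variable tau : 'I_d' -> option 'I_d.

Lemma recast_refl p S (u : fi_M k p S) : recast p u = u.
Proof. by rewrite (recast_ecast (erefl p)). Qed.

Lemma recastK p q (E : p = q) S (u : fi_M k p S) : recast p (recast q u) = u.
Proof. by case: q / E; rewrite !recast_refl. Qed.

Hypothesis tau_embeds : embeds m m' tau.

Lemma cmap_inj S : injective (cmap k m m' tau S).
Proof.
have [mm _ onto] := tau_embeds => L L' E; apply: dsumP => i.
have [r ri] := onto i; have := congr1 (fun L : fi_cover k m' S => L r) E.
rewrite !cmapE ri => /(congr1 (@recast k _ (m i) S)).
by rewrite !recastK // (mm _ _ ri).
Qed.

Lemma cmap_image S (y : fi_cover k m' S) :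
  (forall r, tau r = None -> y r = 0) <-> exists L, cmap k m m' tau S L = y.
Proof.
have [mm tauI onto] := tau_embeds; split=> [y0|[L <-] r tr]; last by rewrite cmapE tr.
have [f fE] := choice onto.
exists (mkdsum (fun i => recast (m i) (y (f i)))); apply: dsumP => r; rewrite cmapE.
case tr: (tau r) => [i|]; last by rewrite y0.
rewrite /=; have -> : f i = r by apply: tauI (fE i) tr.
by rewrite recastK // (mm _ _ tr).
Qed.

End Embedding.

Lemma sequential_of_coord (k : comPzRingType) (d1 d2 : nat) (m : 'I_d1 -> nat)
    (n : 'I_d2 -> nat) (V W : fimod k) (Pi1 : fimor (fi_cover k m) V)
    (Pi2 : fimor (fi_cover k n) W) (phi : fimor V W)
    (tphi : fimor (fi_cover k m) (fi_cover k n)) (tau : 'I_d2 -> option 'I_d1) :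
  (forall r i, tau r = Some i -> n r = m i) ->
  (forall r r' i, tau r = Some i -> tau r' = Some i -> r = r') ->
  (forall S L j, tphi S L j = if tau j is Some i then recast (n j) (L i) else 0) ->
  (forall S L, phi S (Pi1 S L) = Pi2 S (tphi S L)) ->
  sequential_witness Pi1 Pi2 phi tphi.
Proof.
move=> mn tauI tphiE comm.
pose A := [set i | [exists j, tau j == Some i]]; pose B := [set j | tau j != None].
have exf (i : {i | i \in A}) : exists j : {j | j \in B}, tau (val j) = Some (val i).
  have := valP i; rewrite inE => /existsP[j /eqP ji].
  have jB : j \in B by rewrite inE ji.
  by exists (exist _ j jB).
have exg (j : {j | j \in B}) : exists i : {i | i \in A}, tau (val j) = Some (val i).
  have := valP j; rewrite inE; case ji: (tau (val j)) => [i|//] _.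
  have iA : i \in A by rewrite inE; apply/existsP; exists (val j); apply/eqP.
  by exists (exist _ i iA).
have [f fE] := choice exf; have [g gE] := choice exg.
exists A, B, f, g, (fun j => mn _ _ (gE j)); split=> //.
- split=> [i|j]; apply: val_inj; last by apply: tauI (fE _) (gE j).
  by have := fE i; rewrite gE => -[].
- by move=> S L j; rewrite tphiE gE; apply: recast_ecast.
- move=> S L j; rewrite inE negbK => /eqP jN; by rewrite tphiE jN.
Qed.

(** Splicing a short exact sequence with an exact row that starts at its cokernel. *)
Lemma exact_row_cons (k : comPzRingType) (N : nat) (A Q : lmodType k) (J : nat -> lmodType k)
    (iota : {linear A -> J 0%N}) (phi : forall i, {linear J i -> J i.+1})
    (pi : {linear J 0%N -> Q}) (iota' : {linear Q -> J 1%N}) :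
  injective iota -> (forall y, pi y = 0 <-> exists x, iota x = y) ->
  (forall q, exists y, pi y = q) -> (forall y, phi 0%N y = iota' (pi y)) ->
  exact_row N iota' (fun i => phi i.+1) -> exact_row N.+1 iota phi.
Proof.
move=> iotaI piK piS phiE [iota'I ex0 exS]; split=> //.
  move=> y; rewrite -piK phiE; split=> [/(_ isT)|-> _]; last exact: linear0.
  by rewrite -(linear0 iota') => /iota'I.
case=> [_ y|i iN y]; last exact: exS.
apply: iff_trans (ex0 y) _; split=> [[q <-]|[x <-]].
  by have [x <-] := piS q; exists x; rewrite phiE.
by exists (pi x); rewrite phiE.
Qed.

Definition ncons (T : nat -> Type) (x0 : T 0%N) (x : forall i, T i.+1) (i : nat) : T i :=
  if i is i'.+1 then x i' else x0.

Section Range.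
Variables (k : comPzRingType) (V W : fimod k) (p : fimor V W).

Fact fi_range_map S T (f : fi_hom S T) w : mimage (p S) w -> mimage (p T) (fi_map W f w).
Proof. by move=> [v <-]; exists (fi_map V f v); apply: fimor_nat. Qed.

Definition fi_range : fisub W := @FISub k W (fun S => mimage (p S)) fi_range_map.
End Range.

Fact fi_idm_nat (k : comPzRingType) (V : fimod k) S T (f : fi_hom S T) (v : V S) :
  (idfun : {linear V T -> V T}) (fi_map V f v) = fi_map V f ((idfun : {linear V S -> V S}) v).
Proof. by []. Qed.

Definition fi_idm (k : comPzRingType) (V : fimod k) : fimor V V := FIMor (@fi_idm_nat k V).

(** The length can be [D] itself, because the cokernel of the map to the shift is
    generated in degree at most [D - 1]; for [D = 0] there is no cokernel. *)
Theorem sharp_resolution (k : comPzRingType) (D : nat) : noetherian k ->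
  forall (V : fimod k) (d : nat) (m : 'I_d -> nat) (Pi : fimor (fi_cover k m) V),
  fi_surj Pi -> (forall i, (m i <= D)%N) ->
  exists (C : nat) (dJ : nat -> nat) (mJ : forall i, 'I_(dJ i) -> nat)
    (J : nat -> fimod k) (PiJ : forall i, fimor (fi_cover k (mJ i)) (J i))
    (tau : 'I_(dJ 0%N) -> option 'I_d)
    (tphi : forall i, fimor (fi_cover k (mJ i)) (fi_cover k (mJ i.+1)))
    (iota : fimor V (J 0%N)) (phi : forall i, fimor (J i) (J i.+1)),
  let tiota := cmap k m (mJ 0%N) tau in
  (forall i, (i <= D)%N -> sharp_filtration (PiJ i)) /\
  (forall S L, iota S (Pi S L) = PiJ 0%N S (tiota S L)) /\
  (forall S, @exact_row k D (fi_cover k m S) (fun i => fi_cover k (mJ i) S)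
     (tiota S) (fun i => tphi i S)) /\
  (forall n : nat, (C <= n)%N -> @exact_row k D (V 'I_n) (fun i => J i 'I_n)
     (iota 'I_n) (fun i => phi i 'I_n)) /\
  (forall i, (i < D)%N -> sequential_witness (PiJ i) (PiJ i.+1) (phi i) (tphi i)) /\
  (forall i, (i <= D)%N -> forall j, (mJ i j <= D - i)%N) /\
  embeds m (mJ 0%N) tau.
Proof.
move=> k_noeth; elim: D => [|D IH] V d m Pi Pi_surj mD;
  have [a /(_ a (leqnn a))[e [n [P0 [tau [filt inj comm emb low]]]]]] :=
    shift_presentation k_noeth Pi_surj;
  have unitI X := fi_unit_inj inj (X := X);
  have [nm tauI onto] := emb.
- have im S y : exists L, cmap k m n tau S L = y.
    apply/(cmap_image emb) => r /low[i]; by rewrite ltnNge (leq_trans (mD i)).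
  exists a, (fun _ => e), (fun _ => n), (fun _ => fi_shift a V), (fun _ => P0), tau.
  exists (fun _ => fi_idm _), (fi_unit a V), (fun _ => fi_idm _) => tiota.
  split; first by move=> *; exact: filt.
  split; first by move=> S L; rewrite comm.
  split.
    by move=> S; split=> //; exact: cmap_inj emb S.
  split.
    move=> N aN; split=> //; first by apply: unitI; rewrite card_ord.
    move=> y; split=> // _; have [L <-] := filt.1 _ y; have [L' <-] := im _ L.
    by exists (Pi _ L'); rewrite comm.
  split=> //; split=> // i _ r; rewrite leqNgt; apply/negP => r0.
  case tr: (tau r) => [i0|]; first by move: r0; rewrite (nm _ _ tr) ltnNge (leq_trans (mD i0)).
  by have [i0] := low _ tr; rewrite ltnNge (leq_trans (mD i0)).
(* the summands that do not come from the cover of V; they cover the cokernel *)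
pose coker : {set 'I_e} := [set r | tau r == None].
pose v (j : 'I_#|coker|) : 'I_e := enum_val j.
have vI : injective v by exact: enum_val_inj.
have vN j : tau (v j) = None by have := enum_valP j; rewrite inE => /eqP.
have vS r : tau r = None -> exists j, v j = r.
  move=> tr; have rc : r \in coker by rewrite inE tr.
  by exists (enum_rank_in rc r); rewrite /v enum_rankK_in.
pose q (j : 'I_#|coker|) : nat := n (v j).
pose vinv (r : 'I_e) : option 'I_#|coker| := [pick j | v j == r].
have vinvK j : vinv (v j) = Some j.
  by rewrite /vinv; case: pickP => [j' /eqP/vI ->//|/(_ j)]; rewrite eqxx.
pose incl := cmap k q n vinv; pose proj := cmap k n q (fun j => Some (v j)).
have projE S L j : proj S L j = L (v j) by rewrite /proj cmapE recast_refl.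
have inclE S L j : incl S L (v j) = L j by rewrite /incl cmapE vinvK recast_refl.
have projK S L : proj S (incl S L) = L by apply: dsumP => j; rewrite projE inclE.
have ker_proj S L : proj S L = 0 <-> exists L', cmap k m n tau S L' = L.
  apply: iff_trans (cmap_image emb L); split=> [L0 r /vS[j <-]|L0].
    by rewrite -projE L0.
  by apply: dsumP => j; rewrite projE L0.
pose U := fi_range (fi_unit a V).
pose Pi' : fimor (fi_cover k q) (fi_quot U) := fi_mcomp (fi_proj U) (fi_mcomp P0 incl).
have Pi'_proj S L : Pi' S (proj S L) = fi_proj U S (P0 S L).
  have [L' L'E] : exists L', cmap k m n tau S L' = incl S (proj S L) - L.
    by apply/ker_proj; rewrite linearB projK subrr.
  apply/qpi_eq; exists (Pi S L'); rewrite -comm L'E; exact: linearB.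
have Pi'_surj : fi_surj Pi'.
  move=> S w; have [x <-] := qpi_surj w; have [L <-] := filt.1 _ x.
  by exists (proj S L).
have qD j : (q j <= D)%N.
  by have [i lt] := low _ (vN j); rewrite -ltnS; apply: leq_trans lt (mD i).
have [C [dJ [mJ [J [PiJ [tau' [tphi [iota [phi]]]]]]]]] := IH _ _ _ Pi' Pi'_surj qD.
move=> [filt' [comm' [top [bot [seq' [deg' emb']]]]]].
pose dJ1 := ncons (T := fun _ => nat) e dJ.
pose mJ1 := ncons (T := fun i => 'I_(dJ1 i) -> nat) n mJ.
pose J1 := ncons (T := fun _ => fimod k) (fi_shift a V) J.
pose PiJ1 := ncons (T := fun i => fimor (fi_cover k (mJ1 i)) (J1 i)) P0 PiJ.
pose tphi0 := fi_mcomp (cmap k q (mJ 0%N) tau') proj.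
pose phi0 := fi_mcomp iota (fi_proj U).
pose tphi1 := ncons (T := fun i => fimor (fi_cover k (mJ1 i)) (fi_cover k (mJ1 i.+1)))
  tphi0 tphi.
pose phi1 := ncons (T := fun i => fimor (J1 i) (J1 i.+1)) phi0 phi.
have comm0 S L : phi0 S (P0 S L) = PiJ 0%N S (tphi0 S L).
  by rewrite /= -comm' Pi'_proj.
exists (maxn C a), dJ1, mJ1, J1, PiJ1, tau, tphi1, (fi_unit a V), phi1 => tiota.
split; first by case=> [|i] iD; [exact: filt|exact: filt'].
split; first by move=> S L; rewrite [RHS]comm.
split.
  move=> S; apply: (exact_row_cons (pi := proj S) _ _ _ _ (top S)) => //.
  - exact: cmap_inj emb S.
  - by move=> L; exists (incl S L).
split.
  move=> N; rewrite geq_max => /andP[CN aN].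
  apply: (exact_row_cons (pi := fi_proj U 'I_N) _ _ _ _ (bot N CN)) => //.
  - by apply: unitI; rewrite card_ord.
  - by move=> y; apply: qpi_eq0.
  - exact: qpi_surj.
split.
  case=> [_|i iD]; last exact: seq'.
  have [nm' tauI' _] := emb'.
  apply: (@sequential_of_coord _ _ _ _ _ _ _ _ _ _ _ (fun r => omap v (tau' r))) => //.
  - by move=> r i; case tr: (tau' r) => [j|//] [<-]; apply: nm' tr.
  - move=> r r' i; case tr: (tau' r) => [j|//] [<-].
    by case tr': (tau' r') => [j'|//] [/vI jj']; apply: tauI' tr _; rewrite tr' jj'.
  - move=> S L j; rewrite [LHS]cmapE; case: (tau' j) => [i|//].
    exact: (congr1 (@recast k (q i) (mJ 0%N j) S) (projE S L i)).
split.
  case=> [|i] iD j; last by rewrite subSS; apply: deg'.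
  rewrite subn0; case tr: (tau j) => [i|]; first by rewrite [mJ1 _ _](nm _ _ tr).
  by have [i /ltnW/leq_trans] := low _ tr; apply.
exact: emb.
Qed.

Local Close Scope ring_scope.

Theorem theorem1 (k : comPzRingType) (k_noeth : noetherian k)
    (V : fimod k) (D d : nat) (m : 'I_d -> nat) (Pi : fimor (fi_cover k m) V)
    (Pi_surj : fi_surj Pi) (m_le : forall i, (m i <= D)%N) :
  (exists a0 : nat, forall a : nat, (a0 <= a)%N -> sharp_filtered (fi_shift a V))
  /\
  (exists (N C : nat)
     (dJ : nat -> nat) (mJ : forall i, 'I_(dJ i) -> nat)
     (J : nat -> fimod k) (PiJ : forall i, fimor (fi_cover k (mJ i)) (J i))
     (tiota : fimor (fi_cover k m) (fi_cover k (mJ 0%N)))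
     (tphi : forall i, fimor (fi_cover k (mJ i)) (fi_cover k (mJ i.+1)))
     (iota : fimor V (J 0%N))
     (phi : forall i, fimor (J i) (J i.+1)),
     (forall i, (i <= N)%N -> sharp_filtration (PiJ i)) /\
     (forall S L, iota S (Pi S L) = PiJ 0%N S (tiota S L)) /\
     (forall i, (i < N)%N -> forall S L,
        phi i S (PiJ i S L) = PiJ i.+1 S (tphi i S L)) /\
     (forall S : finType,
        @exact_row k N (fi_cover k m S) (fun i => fi_cover k (mJ i) S)
          (tiota S) (fun i => tphi i S)) /\
     (forall n : nat, (C <= n)%N ->
        @exact_row k N (V 'I_n) (fun i => J i 'I_n)
          (iota 'I_n) (fun i => phi i 'I_n)) /\
     (forall i, (i < N)%N ->
        sequential_witness (PiJ i) (PiJ i.+1) (phi i) (tphi i)) /\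
     (N <= D)%N /\
     (forall i, (i <= N)%N -> gen_in_degree_le (fi_cover k (mJ i)) (D - i))).
Proof.
split.
  have [a0 a0P] := shift_presentation k_noeth Pi_surj.
  by exists a0 => a /a0P[e [n [P0 [tau [filt _ _ _ _]]]]]; exists e, n, P0.
have [C [dJ [mJ [J [PiJ [tau [tphi [iota [phi]]]]]]]]] :=
  sharp_resolution k_noeth Pi_surj m_le.
move=> [filt [comm [top [bot [seq [degs _]]]]]].
exists D, C, dJ, mJ, J, PiJ, (cmap k m (mJ 0%N) tau), tphi, iota, phi.
split=> //; split=> //; split.
  by move=> i iD; have [A [B [f [g [nm []]]]]] := seq i iD.
do 4! (split=> //); move=> i iD.
exists _, (mJ i), (fi_idm _); split; last by move=> j; apply: degs.
by move=> S w; exists w.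
Qed.
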